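(* Let $J=[0,T]$ with $T>0$, let $0<\alpha<1$, let $\omega_0\in\mathbb{R}$, let $f\in C(J\times\mathbb{R},\mathbb{R}\setminus\{0\})$ be such that $\tau\mapsto u/f(\tau,u)$ is absolutely continuous on $J$ for each $u\in\mathbb{R}$, and let $g\in C(J\times\mathbb{R},\mathbb{R})$. Assume that for each $\tau\in J$ the map $x\mapsto \dfrac{x}{f(\tau,x)}$ is strictly increasing on $\mathbb{R}$. Let $\omega\in AC(J,\mathbb{R})$ be such that the function $F_\omega(\tau)=\dfrac{\omega(\tau)}{f(\tau,\omega(\tau))}$ has an ABC-derivative ${}^{ABC}{}_0\mathcal{D}^\alpha_\tau F_\omega\in C(J)$, and such that $g(0,\omega(0))=0$. Then $\omega$ is a solution of the ABC-hybrid problem $$ {}^{ABC}{}_0\mathcal{D}^\alpha_\tau\left(\frac{\omega(\tau)}{f(\tau,\omega(\tau))}\right)=g(\tau,\omega(\tau))\ \text{ for a.e. }\tau\in J,\qquad \omega(0)=\omega_0, $$ if and only if $\omega$ satisfies, for all $\tau\in J$, the fractional integral equation $$ \omega(\tau)=f(\tau,\omega(\tau))\left[\frac{\omega_0}{f(0,\omega_0)}+\frac{1-\alpha}{B(\alpha)}\,g(\tau,\omega(\tau))+\frac{\alpha}{B(\alpha)\Gamma(\alpha)}\int_0^\tau(\tau-\sigma)^{\alpha-1}g(\sigma,\omega(\sigma))\,d\sigma\right]. $$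
   Context: $AC(J,\mathbb{R})$ is the set of absolutely continuous functions $J\to\mathbb{R}$. $B$ is a fixed normalization function on $[0,1]$ with $B(\alpha)>0$ and $B(0)=B(1)=1$. $\mathbb{E}_\alpha(z)=\sum_{n=0}^\infty \frac{z^n}{\Gamma(n\alpha+1)}$ is the one-parameter Mittag-Leffler function. For $x\in H^1(0,T)$ the left Atangana--Baleanu--Caputo (ABC) fractional derivative of order $\alpha$ is $$ {}^{ABC}{}_0\mathcal{D}^\alpha_\tau x(\tau)=\frac{B(\alpha)}{1-\alpha}\int_0^\tau \mathbb{E}_\alpha\left[-\frac{\alpha}{1-\alpha}(\tau-\sigma)^\alpha\right]x'(\sigma)\,d\sigma ; $$ saying that $x$ has an ABC-derivative means $x\in H^1(0,T)$. A solution of the ABC-hybrid problem is a function $\omega\in AC(J,\mathbb{R})$ such that $F_\omega(\tau)=\omega(\tau)/f(\tau,\omega(\tau))$ has an ABC-derivative in $C(J)$, the differential equation holds for a.e. $\tau\in J$, and $\omega(0)=\omega_0$. *)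

(* Defs.v *)
From HB Require Import structures.
From mathcomp Require Import all_boot all_order all_algebra.
From mathcomp Require Import all_classical all_reals all_analysis.
Set Implicit Arguments.
Unset Strict Implicit.
Unset Printing Implicit Defensive.
Import Order.TTheory GRing.Theory Num.Theory.
Import numFieldNormedType.Exports.
Local Open Scope classical_set_scope.
Local Open Scope ring_scope.

Definition gamma_fun (R : realType) (x : R) : R :=
  \int[lebesgue_measure]_(t in `]0, +oo[) (t `^ (x - 1) * expR (- t)).

Definition mittag_leffler (R : realType) (alpha z : R) : R :=
  limn (series (fun n : nat => z ^+ n / gamma_fun (n%:R * alpha + 1))).

(* The finite families of pairwise disjoint subintervals are ]a_i, b_i[, i < n *)
Definition abs_continuous (R : realType) (lo hi : R) (u : R -> R) : Prop :=
  forall e : R, 0 < e -> exists2 d : R, 0 < d &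
    forall (n : nat) (a b : 'I_n -> R),
      (forall i, lo <= a i /\ a i <= b i /\ b i <= hi) ->
      trivIset [set: 'I_n] (fun i => [set` `]a i, b i[]) ->
      \sum_(i < n) (b i - a i) < d ->
      \sum_(i < n) `|u (b i) - u (a i)| < e.

Definition in_L2 (R : realType) (T : R) (u : R -> R) : Prop :=
  u \_ [set` `]0, T[] \in Lfun (@lebesgue_measure R) 2%:E.

(* C^1 functions with compact support in ]0, T[, extended by 0 to the line *)
Definition test_function (R : realType) (T : R) (phi : R -> R) : Prop :=
  [/\ forall t, derivable phi t 1,
      continuous (derive1 phi),
      compact (closure [set t | phi t != 0]) &
      closure [set t | phi t != 0] `<=` [set` `]0, T[] ].

Definition is_weak_derivative (R : realType) (T : R) (x v : R -> R) : Prop :=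
  forall phi, test_function T phi ->
    \int[lebesgue_measure]_(t in `]0, T[) (x t * derive1 phi t) =
    - \int[lebesgue_measure]_(t in `]0, T[) (v t * phi t).

(* H^1(0, T) = W^{1,2}(0, T) *)
Definition in_H1 (R : realType) (T : R) (x : R -> R) : Prop :=
  in_L2 T x /\ exists v, in_L2 T v /\ is_weak_derivative T x v.

(* The weak derivative in L^2(0, T), unique up to a null subset of ]0, T[;
   meaningful only for x in H^1(0, T) *)
Definition weak_derivative (R : realType) (T : R) (x : R -> R) : R -> R :=
  xget (fun=> 0) [set v | in_L2 T v /\ is_weak_derivative T x v].

(* Meaningful only for x in H^1(0, T), as x' is taken in the weak sense *)
Definition abc_derivative (R : realType) (B : R -> R) (alpha T : R)
    (x : R -> R) (tau : R) : R :=
  B alpha / (1 - alpha) *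
  \int[lebesgue_measure]_(s in `[0, tau])
    (mittag_leffler alpha (- (alpha / (1 - alpha)) * (tau - s) `^ alpha)
     * weak_derivative T x s).

Definition has_continuous_abc_derivative (R : realType) (B : R -> R)
    (alpha T : R) (x : R -> R) : Prop :=
  in_H1 T x /\
  {within [set` `[0, T]], continuous (abc_derivative B alpha T x)}.

Definition hybrid_quotient (R : realType) (f : R * R -> R) (w : R -> R) :
  R -> R := fun tau => w tau / f (tau, w tau).

Definition is_abc_hybrid_solution (R : realType) (B : R -> R) (alpha T : R)
    (f g : R * R -> R) (w0 : R) (w : R -> R) : Prop :=
  [/\ abs_continuous 0 T w,
      has_continuous_abc_derivative B alpha T (hybrid_quotient f w),
      {ae lebesgue_measure, forall tau : R, tau \in `[0, T] ->
        abc_derivative B alpha T (hybrid_quotient f w) tau = g (tau, w tau)} &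
      w 0 = w0].

(* Main.v *)
Require Import Defs.
From HB Require Import structures.
From mathcomp Require Import all_boot all_order all_algebra.
From mathcomp Require Import all_classical all_reals all_analysis.
From mathcomp Require Import measurable_realfun.
From mathcomp Require Import ring lra.
Import Order.TTheory GRing.Theory Num.Theory.
Import numFieldNormedType.Exports.
Local Open Scope classical_set_scope.
Local Open Scope ring_scope.

(** Write a # b for the causal convolution, the integral of a(t - s) b(s) over
    0 <= s <= t, p_a(s) = s^(a-1) / Gamma(a) for the kernel of the fractional
    integral of order a, and k = alpha / (1 - alpha).  The kernel
    E(s) = E_alpha(- k s^alpha) of the ABC derivative solves the Volterra
    equation with kernel k p_alpha and right-hand side 1:

      E + k (p_alpha # E) = 1                            [ml_kernel_resolvent].

    Term by term this is the semigroup law p_a # p_b = p_(a+b)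
    [frac_kernel_semigroup], which is the relation between Euler's Beta and
    Gamma integrals; the series of E may be integrated termwise because Gamma
    grows faster than every geometric sequence [gamma_fun_geX].

    The ABC derivative of F is D = B(alpha) / (1 - alpha) (E # F').  Convolving
    it with p_alpha and using associativity [convol_assoc] and the resolvent
    identity yields the Newton-Leibniz formula [abc_integral_derivative]

      (1 - alpha) / B(alpha) D + alpha / B(alpha) (p_alpha # D) = 1 # F' = F - F(0).

    Here F' is only a weak derivative in L^2; that its primitive is the
    continuous function F up to a constant is found by testing against smooth
    approximations of the indicator of ]x, y] [weak_derivative_FTC].

    Take F(t) = w(t) / f(t, w(t)).  If D(t) = g(t, w(t)) for almost every t, then
    for every t by continuity, and the formula becomes the integral equation.
    Conversely, at time 0 the integral equation reads
    w(0) / f(0, w(0)) = w0 / f(0, w0), since g(0, w(0)) = 0; hence w(0) = w0 by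
    strict monotonicity.  Subtracting the formula from the integral equation
    shows that h(t) = g(t, w(t)) - D(t) solves h + k (p_alpha # h) = 0.
    Convolving with E turns this into 1 # h = 0, so h = 0 [volterra_unique]. *)

(** * Affine changes of variable and convolution on the line *)

Section affine.
Context {R : realType}.
Local Notation mu := (@lebesgue_measure R).
Implicit Types (a b c : R -> R).

(** By uniqueness of Lebesgue measure it suffices to compare half-open
    intervals; the preimage of one is an interval shorter by the factor |m|,
    closed on the right or on the left according to the sign of m. *)
Lemma lebesgue_measure_affine (m c : R) (A : set R) : m != 0 -> measurable A ->
  mu A = (`|m|%:E * pushforward mu (fun x : R => (m * x + c)%R : measurableTypeR R) A)%E.
Proof.
move=> m0 mA.
have mphi : measurable_fun setT (fun x : R => m * x + c : measurableTypeR R).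
  exact: measurable_funD.
pose phi : {mfun _ >-> _} := HB.pack (fun x : R => m * x + c : measurableTypeR R)
  (isMeasurableFun.Build _ _ _ _ _ mphi).
rewrite (@lebesgue_measure_unique R (mscale (NngNum (normr_ge0 m)) (pushforward mu phi)))//.
move=> _ [[a b]] _ <-.
transitivity (`|m|%:E * mu ((fun x : R => (m * x + c)%R) @^-1` `]a, b]))%E; last by [].
have [m_gt0|m_lt0|m_eq0] := ltgtP 0 m; last by rewrite m_eq0 eqxx in m0.
- rewrite (_ : _ @^-1` _ = `](a - c) / m, (b - c) / m]%classic).
    rewrite !lebesgue_measure_itv/= !lte_fin ltr_pM2r ?invr_gt0// ltrD2r.
    case: ifPn => _; last by rewrite mule0.
    by rewrite -!EFinB -EFinM gtr0_norm//; congr (_%:E); field.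
  apply/seteqP; split => x /=; rewrite !in_itv/= ltr_pdivrMr// ler_pdivlMr//
    ltrBlDr lerBrDr mulrC//.
- rewrite (_ : _ @^-1` _ = `[(b - c) / m, (a - c) / m[%classic).
    rewrite !lebesgue_measure_itv/= !lte_fin ltr_nM2r ?invr_lt0// ltrD2r.
    case: ifPn => _; last by rewrite mule0.
    by rewrite -!EFinB -EFinM ltr0_norm//; congr (_%:E); field.
  apply/seteqP; split => x /=; rewrite !in_itv/= ltr_ndivlMr// ler_ndivrMr//
    ltrBlDr lerBrDr mulrC andbC//.
Qed.

Lemma ge0_integral_affine (m c : R) (f : R -> \bar R) : m != 0 ->
  measurable_fun setT f -> (forall x, 0 <= f x)%E ->
  (\int[mu]_x f x = `|m|%:E * \int[mu]_x f (m * x + c)%R)%E.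
Proof.
move=> m0 mf f0.
have mphi : measurable_fun setT (fun x : R => m * x + c : measurableTypeR R).
  exact: measurable_funD.
pose phi : {mfun _ >-> _} := HB.pack (fun x : R => m * x + c : measurableTypeR R)
  (isMeasurableFun.Build _ _ _ _ _ mphi).
rewrite (eq_measure_integral (mscale (NngNum (normr_ge0 m)) (pushforward mu phi))).
  rewrite ge0_integral_mscale//=; congr (_ * _)%E.
  by rewrite ge0_integral_pushforward.
by move=> A mA _; exact: lebesgue_measure_affine.
Qed.

Lemma Rintegral_affine (m c : R) (f : R -> R) : m != 0 -> measurable_fun setT f ->
  \int[mu]_x f x = `|m| * \int[mu]_x f (m * x + c).
Proof.
move=> m0 mf; have mf' : measurable_fun setT (EFin \o f) by exact/measurable_EFinP.
rewrite /Rintegral integralE [in RHS]integralE.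
rewrite (ge0_integral_affine m c _ m0 (measurable_funepos mf') (funepos_ge0 _)).
rewrite (ge0_integral_affine m c _ m0 (measurable_funeneg mf') (funeneg_ge0 _)).
have -> : (\int[mu]_x (fun y => (f (m * y + c))%:E)^\+ x =
           \int[mu]_x (EFin \o f)^\+ (m * x + c)%R)%E.
  by apply: eq_integral => x _; rewrite !funeposE.
have -> : (\int[mu]_x (fun y => (f (m * y + c))%:E)^\- x =
           \int[mu]_x (EFin \o f)^\- (m * x + c)%R)%E.
  by apply: eq_integral => x _; rewrite !funenegE.
have [a0 b0] : (0 <= \int[mu]_x (EFin \o f)^\+ (m * x + c)%R)%E /\
    (0 <= \int[mu]_x (EFin \o f)^\- (m * x + c)%R)%E.
  by split; apply: integral_ge0 => x _.
(* if one of the two parts diverges, fine makes both sides vanish *)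
have m0' : (0%:E < `|m|%:E)%E by rewrite lte_fin normr_gt0.
move: (integral _ _ _) (integral _ _ _) a0 b0 => [a| |] [b| |] // _ _;
  rewrite ?gt0_muley//= ?mulr0//.
by rewrite mulrBr.
Qed.

Definition unif_bounded a := exists M : R, forall x, `|a x| <= M.

Lemma integrable_measurable a : mu.-integrable setT (EFin \o a) -> measurable_fun setT a.
Proof. by move=> /measurable_int/measurable_EFinP. Qed.

Lemma Rintegral_shift (k : R) a : measurable_fun setT a ->
  \int[mu]_x a x = \int[mu]_x a (x + k).
Proof.
move=> ma; rewrite (Rintegral_affine 1 k)// normr1 mul1r.
by apply: eq_Rintegral => x _; rewrite mul1r.
Qed.

Lemma Rintegral_reflect (k : R) a : measurable_fun setT a ->
  \int[mu]_x a x = \int[mu]_x a (k - x).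
Proof.
move=> ma; rewrite (Rintegral_affine (-1) k)// ?oppr_eq0 ?oner_eq0// normrN1 mul1r.
by apply: eq_Rintegral => x _; rewrite mulN1r addrC.
Qed.

Lemma integrable_affine (m k : R) a : m != 0 ->
  mu.-integrable setT (EFin \o a) -> mu.-integrable setT (EFin \o (fun x => a (m * x + k))).
Proof.
move=> m0 ia; have ma := integrable_measurable _ ia.
have ma' : measurable_fun setT (fun x => a (m * x + k)).
  by apply: measurableT_comp => //; exact: measurable_funD.
move/integrableP : ia => [_ ia]; apply/integrableP; split; first exact/measurable_EFinP.
move: ia; rewrite (ge0_integral_affine m k _ m0)//; last first.
  by apply: measurableT_comp => //; exact/measurable_EFinP.
have : (0 <= \int[mu]_x `|(EFin \o a) (m * x + k)%R|)%E by exact: integral_ge0.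
case: (integral _ _ _) => [r| |]//= _; rewrite ?ltry//.
by rewrite gt0_muley// lte_fin normr_gt0.
Qed.

Lemma integrable_reflect (k : R) a : mu.-integrable setT (EFin \o a) ->
  mu.-integrable setT (EFin \o (fun x => a (k - x))).
Proof.
move=> ia; rewrite (_ : (fun x => _) = (fun x => a (-1 * x + k))).
  by apply: integrable_affine; rewrite ?oppr_eq0 ?oner_eq0.
by apply/funext => x; rewrite mulN1r addrC.
Qed.

Lemma integrable_shift (k : R) a : mu.-integrable setT (EFin \o a) ->
  mu.-integrable setT (EFin \o (fun x => a (x - k))).
Proof.
move=> ia; rewrite (_ : (fun x => _) = (fun x => a (1 * x + - k))).
  by apply: integrable_affine; rewrite ?oner_eq0.
by apply/funext => x; rewrite mul1r.
Qed.

Lemma integrableM_bounded a b :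
  mu.-integrable setT (EFin \o a) -> mu.-integrable setT (EFin \o b) ->
  unif_bounded a \/ unif_bounded b ->
  mu.-integrable setT (EFin \o (fun x => a x * b x)).
Proof.
move=> ia ib bab.
have ma := integrable_measurable _ ia; have mb := integrable_measurable _ ib.
have mab : measurable_fun setT (EFin \o (fun x => a x * b x)).
  by apply/measurable_EFinP; exact: measurable_funM.
case: bab => -[M bM].
- apply: (@le_integrable _ _ _ mu setT measurableT _ (fun x => (M * b x)%:E) mab);
    last exact: (integrableZl measurableT M ib).
  move=> x _.
  rewrite /= lee_fin !normrM ler_wpM2r//.
  exact: (le_trans (bM x) (ler_norm _)).
- apply: (@le_integrable _ _ _ mu setT measurableT _ (fun x => (M * a x)%:E) mab);
    last exact: (integrableZl measurableT M ia).
  move=> x _.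
  rewrite /= lee_fin !normrM mulrC ler_wpM2r//.
  exact: (le_trans (bM x) (ler_norm _)).
Qed.

(** Fubini for K(s, r) = a(t - s) b(s - r) c(r), followed by a translation by r
    in the inner integral.  The first alternative bounds the integral of
    |a(t - s) b(s - r)| over s uniformly in r, which makes K integrable.  The
    second makes b(s - r) c(r) integrable in r for every s and not only for
    almost every s, so that the inner real-valued integrals are the extended
    ones that Fubini speaks of. *)
Lemma line_convol_assoc a b c (t : R) :
  mu.-integrable setT (EFin \o a) -> mu.-integrable setT (EFin \o b) ->
  mu.-integrable setT (EFin \o c) ->
  unif_bounded a \/ unif_bounded b -> unif_bounded b \/ unif_bounded c ->
  \int[mu]_s (a (t - s) * \int[mu]_r (b (s - r) * c r)) =
  \int[mu]_r (\int[mu]_s (a (t - r - s) * b s) * c r).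
Proof.
move=> ia ib ic bab bbc.
have ma := integrable_measurable _ ia; have mb := integrable_measurable _ ib.
have mc := integrable_measurable _ ic.
pose K (z : R * R) := a (t - z.1) * (b (z.1 - z.2) * c z.2).
have mK : measurable_fun setT (EFin \o K).
  apply/measurable_EFinP; apply: measurable_funM.
    by apply: measurableT_comp => //; exact: measurable_funB.
  apply: measurable_funM; last by apply: measurableT_comp.
  by apply: measurableT_comp => //; exact: measurable_funB.
have mnK : measurable_fun setT (abse \o (EFin \o K)) by exact: measurableT_comp.
have iab r : mu.-integrable setT (EFin \o (fun s => a (t - s) * b (s - r))).
  apply: integrableM_bounded; [exact: integrable_reflect|exact: integrable_shift|].
  by case: bab => -[M bM]; [left|right]; exists M => x; exact: bM.
have ibc s : mu.-integrable setT (EFin \o (fun r => b (s - r) * c r)).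
  apply: integrableM_bounded; [exact: integrable_reflect|exact: ic|].
  by case: bbc => -[M bM]; [left|right]; exists M => x; exact: bM.
(* N is the bound of the bounded factor times the L1 norm of the other one *)
have [N N0 bN] : exists2 N : R, 0 <= N &
    forall r, \int[mu]_s `|a (t - s) * b (s - r)| <= N.
  have nab r : mu.-integrable setT (EFin \o (fun s => `|a (t - s) * b (s - r)|)).
    exact: (integrable_norm (iab r)).
  case: bab => -[M bM].
  - have M0 : 0 <= M by exact: le_trans (bM 0).
    exists (M * \int[mu]_s `|b s|).
      by rewrite mulr_ge0// Rintegral_ge0.
    move=> r; rewrite (Rintegral_shift (- r) (fun s => `|b s|))//; last exact: measurableT_comp.
    have inb := integrable_norm (integrable_shift r _ ib).
    rewrite -RintegralZl//; apply: le_Rintegral => //.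
      exact: (@integrableZl _ _ _ mu setT measurableT M _ inb).
    by move=> x _; rewrite normrM ler_wpM2r.
  - have M0 : 0 <= M by exact: le_trans (bM 0).
    exists (M * \int[mu]_s `|a s|).
      by rewrite mulr_ge0// Rintegral_ge0.
    move=> r; rewrite (Rintegral_reflect t (fun s => `|a s|))//; last exact: measurableT_comp.
    have ina := integrable_norm (integrable_reflect t _ ia).
    rewrite -RintegralZl//; apply: le_Rintegral => //.
      exact: (@integrableZl _ _ _ mu setT measurableT M _ ina).
    by move=> x _; rewrite normrM mulrC ler_wpM2r.
have iK : (mu \x mu)%E.-integrable setT (EFin \o K).
  apply: (@integrable21ltyP _ _ _ _ R mu mu _ mK).2.
  apply: (@le_lt_trans _ _ (\int[mu]_r (N%:E * `|(c r)%:E|))%E).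
    apply: ge0_le_integral => //.
    - by move=> r _; exact: integral_ge0.
    - exact: (@measurable_fun_fubini_tonelli_G _ _ _ _ R mu _ mnK (fun=> abse_ge0 _)).
    - apply: measurable_funeM; apply/measurableT_comp => //; exact/measurable_EFinP.
    move=> r _.
    rewrite (_ : \int[mu]_x _ = \int[mu]_s (`|(c r)%:E| * (`|a (t - s) * b (s - r)|)%:E))%E.
      rewrite ge0_integralZl//; last first.
        apply/measurable_EFinP; apply: measurableT_comp => //.
        exact: (integrable_measurable _ (iab r)).
      rewrite muleC; apply: lee_wpmul2r => //.
      rewrite -[leLHS]fineK; first by rewrite lee_fin; exact: bN.
      apply: integrable_fin_num => //; exact: (integrable_norm (iab r)).
    by apply: eq_integral => s _; rewrite /K /= -EFinM -!normrM; congr (`|_|%:E); ring.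
  rewrite ge0_integralZl//; last first.
    by apply/measurableT_comp => //; exact/measurable_EFinP.
  apply: lte_mul_pinfty => //.
  by move/integrableP : ic => [].
have FK := Fubini iK.
apply: (congr1 fine).
have -> : (\int[mu]_s (a (t - s) * \int[mu]_r (b (s - r) * c r))%:E =
           \int[mu]_s \int[mu]_r (EFin \o K) (s, r))%E.
  apply: eq_integral => s _; rewrite EFinM fineK;
    last exact: (integrable_fin_num measurableT (ibc s)).
  rewrite -(@integralZl _ _ _ mu _ measurableT _ (ibc s) (a (t - s))).
  by apply: eq_integral => r _.
rewrite FK; apply: eq_integral => r _.
rewrite (_ : \int[mu]_s (a (t - r - s) * b s) = \int[mu]_s (a (t - s) * b (s - r))).
  rewrite EFinM fineK; last exact: (integrable_fin_num measurableT (iab r)).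
  rewrite -(integralZr measurableT (iab r)); apply: eq_integral => s _.
  by rewrite /K /= -EFinM mulrA.
rewrite (Rintegral_shift (- r)).
  by apply: eq_Rintegral => s _; congr (a _ * _); ring.
apply: measurable_funM => //; apply: measurableT_comp => //; exact: measurable_funB.
Qed.

Lemma Rdominated_cvg (D : set R) (f_ : nat -> R -> R) (f g : R -> R) :
  measurable D -> (forall n, measurable_fun D (f_ n)) ->
  (forall x, D x -> f_ ^~ x @ \oo --> f x) ->
  mu.-integrable D (EFin \o g) ->
  (forall n x, D x -> `|f_ n x| <= g x) ->
  \int[mu]_(x in D) f_ n x @[n --> \oo] --> \int[mu]_(x in D) f x.
Proof.
move=> mD mf_ f_f ig f_g.
have mf : measurable_fun D f := measurable_fun_cvg mf_ f_f.
have [if_ _ cv] : [/\ mu.-integrable D (EFin \o f),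
    [sequence \int[mu]_(x in D) `|(f_ n x)%:E - (f x)%:E|]_n @ \oo --> 0 &
    [sequence \int[mu]_(x in D) (f_ n x)%:E]_n @ \oo --> \int[mu]_(x in D) (f x)%:E]%E.
  apply: (@dominated_convergence _ _ R mu D mD _ _ (EFin \o g)) => //.
  - by move=> n; apply/measurable_EFinP; exact: mf_.
  - exact/measurable_EFinP.
  - by apply: aeW => x Dx; apply: cvg_EFin; [exact: nearW|exact: f_f].
  - by apply: aeW => x n Dx; rewrite lee_fin f_g.
apply: fine_cvg; rewrite fineK//.
exact: integrable_fin_num.
Qed.

End affine.

(** * Causal convolution *)

Section convol.
Context {R : realType}.
Local Notation mu := (@lebesgue_measure R).
Implicit Types (a b c : R -> R) (t : R).

Definition convol a b t : R := \int[mu]_(s in `[0, t]) (a (t - s) * b s).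

Definition bounded_upto t a := exists M : R, forall x, 0 <= x <= t -> `|a x| <= M.

(** Cutting both factors off outside [0, u] turns the causal convolution into a
    convolution on the whole line, where translations and reflections act; for
    t <= u only values inside [0, u] enter. *)
Lemma convol_patch a b (t u : R) : t <= u ->
  convol a b t = \int[mu]_s ((a \_ `[0, u]) (t - s) * (b \_ `[0, u]) s).
Proof.
move=> tu; rewrite /convol Rintegral_mkcond; apply: eq_Rintegral => s _.
rewrite !patchE !mem_setE !in_itv/=.
have [s0|s0] := leP 0 s => /=; last by rewrite mulr0.
rewrite subr_ge0; case: (leP s t) => st /=; last by rewrite mul0r.
by rewrite lerBlDr (le_trans tu) ?lerDl// (le_trans st tu).
Qed.

Lemma bounded_upto_patch t a : bounded_upto t a -> unif_bounded (a \_ `[0, t]).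
Proof.
move=> [M aM]; exists (Num.max M 0) => x; rewrite patchE mem_setE in_itv/=.
by case: ifPn => [/aM h|_]; rewrite le_max ?h// normr0 lexx orbT.
Qed.

Lemma integrable_patch t a : mu.-integrable `[0, t] (EFin \o a) ->
  mu.-integrable setT (EFin \o (a \_ `[0, t])).
Proof.
move=> ia; rewrite -restrict_EFin; exact: (@integrable_mkcond _ _ _ mu _ _ _).1.
Qed.

(** The reflection s |-> t - s of the line. *)
Lemma convol_comm a b t : measurable_fun `[0, t] a -> measurable_fun `[0, t] b ->
  convol a b t = convol b a t.
Proof.
move=> ma mb; rewrite !(@convol_patch _ _ t t)//.
have ma' : measurable_fun setT (a \_ `[0, t]) by apply/(measurable_restrictT _ _).1.
have mb' : measurable_fun setT (b \_ `[0, t]) by apply/(measurable_restrictT _ _).1.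
rewrite (Rintegral_reflect t).
  by apply: eq_Rintegral => s _; rewrite subKr mulrC.
by apply: measurable_funM => //; apply: measurableT_comp => //; exact: measurable_funB.
Qed.

Lemma convol_assoc a b c t :
  mu.-integrable `[0, t] (EFin \o a) -> mu.-integrable `[0, t] (EFin \o b) ->
  mu.-integrable `[0, t] (EFin \o c) ->
  bounded_upto t a \/ bounded_upto t b -> bounded_upto t b \/ bounded_upto t c ->
  convol a (convol b c) t = convol (convol a b) c t.
Proof.
move=> ia ib ic bab bbc.
set a' := a \_ `[0, t]; set b' := b \_ `[0, t]; set c' := c \_ `[0, t].
have := @line_convol_assoc R a' b' c' t (integrable_patch _ _ ia)
  (integrable_patch _ _ ib) (integrable_patch _ _ ic).
have bab' : unif_bounded a' \/ unif_bounded b'.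
  by case: bab => /bounded_upto_patch; [left|right].
have bbc' : unif_bounded b' \/ unif_bounded c'.
  by case: bbc => /bounded_upto_patch; [left|right].
move=> /(_ bab' bbc') abc.
rewrite (@convol_patch a _ t t)// (@convol_patch _ c t t)//.
transitivity (\int[mu]_s (a' (t - s) * \int[mu]_r (b' (s - r) * c' r))).
  apply: eq_Rintegral => s _; have [s0t|] := boolP (s \in `[0, t]%classic).
    rewrite (patchE (convol b c)) s0t; congr (_ * _); apply: convol_patch.
    by move: s0t; rewrite mem_setE in_itv/= => /andP[].
  (* for s > t the factor a' vanishes, for s < 0 the inner integrand does *)
  move=> ns.
  rewrite (patchE (convol b c)) (negbTE ns) mulr0.
  have [sn|s0] := ltP s 0; last first.
    move: ns; rewrite mem_setE in_itv/= s0/= -ltNge => ts.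
    by rewrite /a' patchE mem_setE in_itv/= subr_ge0 leNgt ts mul0r.
  rewrite (_ : \int[mu]_r _ = \int[mu]_(r in set0) (b' (s - r) * c' r)).
    by rewrite Rintegral_set0 mulr0.
  rewrite [RHS]Rintegral_mkcond; apply: eq_Rintegral => r _.
  rewrite /b' /c' !patchE !mem_setE !in_itv/= in_set0.
  rewrite subr_ge0; case: ifPn => [/andP[rs _]|]; last by rewrite mul0r.
  by rewrite (lt_geF (le_lt_trans rs sn)) mulr0.
rewrite abc; apply: eq_Rintegral => r _; rewrite /c' patchE.
case: ifPn => [|_]; last by rewrite !mulr0.
rewrite mem_setE in_itv/= => /andP[r0 rt]; congr (_ * _).
rewrite patchE mem_setE in_itv/= subr_ge0 rt lerBlDr lerDl r0/=.
by rewrite (@convol_patch _ _ _ t)// lerBlDr lerDl.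
Qed.

Lemma integrable_convol (a b : R -> R) (t : R) :
  mu.-integrable `[0, t] (EFin \o a) -> mu.-integrable `[0, t] (EFin \o b) ->
  bounded_upto t a \/ bounded_upto t b ->
  mu.-integrable `[0, t] (EFin \o (fun s => a (t - s) * b s)).
Proof.
move=> ia ib bab.
have := @integrableM_bounded R _ _ (integrable_reflect t _ (integrable_patch _ _ ia))
  (integrable_patch _ _ ib).
have bab' : unif_bounded (fun s => (a \_ `[0, t]) (t - s)) \/ unif_bounded (b \_ `[0, t]).
  case: bab => /bounded_upto_patch; last by right.
  by move=> [M aM]; left; exists M => x; exact: aM.
move=> /(_ bab') i.
have : mu.-integrable `[0, t] (EFin \o (fun s => (a \_ `[0, t]) (t - s) * (b \_ `[0, t]) s)).
  by apply: integrableS i.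
apply: eq_integrable => // s; rewrite inE/= => st.
rewrite !patchE !mem_setE st.
move: st; rewrite !in_itv/= subr_ge0 => /andP[s0 ->].
by rewrite lerBlDr lerDl s0.
Qed.

Lemma convolDr (a b c : R -> R) (t : R) :
  mu.-integrable `[0, t] (EFin \o a) -> mu.-integrable `[0, t] (EFin \o b) ->
  mu.-integrable `[0, t] (EFin \o c) ->
  bounded_upto t a \/ bounded_upto t b ->
  bounded_upto t a \/ bounded_upto t c ->
  convol a (fun s => b s + c s) t = convol a b t + convol a c t.
Proof.
move=> ia ib ic ab ac; rewrite /convol -RintegralD//; last 2 first.
- exact: integrable_convol.
- exact: integrable_convol.
by apply: eq_Rintegral => s _; rewrite mulrDr.
Qed.

Lemma convolZr (a b : R -> R) (k t : R) :
  mu.-integrable `[0, t] (EFin \o a) -> mu.-integrable `[0, t] (EFin \o b) ->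
  bounded_upto t a \/ bounded_upto t b ->
  convol a (fun s => k * b s) t = k * convol a b t.
Proof.
move=> ia ib ab; rewrite /convol -RintegralZl//; last exact: integrable_convol.
by apply: eq_Rintegral => s _; rewrite mulrCA.
Qed.

Lemma bounded_upto_integrable (a : R -> R) (t : R) : measurable_fun `[0, t] a ->
  bounded_upto t a -> mu.-integrable `[0, t] (EFin \o a).
Proof.
move=> ma [M aM]; apply: measurable_bounded_integrable => //.
  change (mu `[0%R, t]%classic < +oo)%E; rewrite lebesgue_measure_itv/=.
  by case: ifPn => _; rewrite -?EFinB ltry.
exists M; split; first exact: num_real.
move=> N MN x /andP[]; rewrite !bnd_simp => x0 xt.
by apply: le_trans (ltW MN); apply: aM; rewrite x0.
Qed.

End convol.

(** * The Gamma function and the kernels of fractional integration *)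

Section gamma.
Context {R : realType}.
Local Notation mu := (@lebesgue_measure R).

Definition gamma_integrand (a x : R) : R := x `^ (a - 1) * expR (- x).

Lemma gamma_integrand_ge0 a x : 0 <= gamma_integrand a x.
Proof. by rewrite mulr_ge0 ?powR_ge0 ?expR_ge0. Qed.

Lemma measurable_gamma_integrand a : measurable_fun setT (gamma_integrand a).
Proof.
apply: measurable_funM => //.
by apply: measurableT_comp => //; exact: measurable_expR.
Qed.

Lemma continuous_powR (a x : R) : 0 < x -> {for x, continuous (fun y : R => y `^ a)}.
Proof.
move=> x0; have [dx _] := @is_derive1_powR R a _ x0.
by apply: differentiable_continuous; apply/derivable1_diffP.
Qed.

Lemma integral_powR_itv (a e : R) : 0 < a -> 0 < e -> e < 1 ->
  (\int[mu]_(x in `[e, 1%R]) (x `^ (a - 1)%R)%:E = ((1 - e `^ a) / a)%R%:E)%E.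
Proof.
move=> a0 e0 e1.
rewrite (@continuous_FTC2 _ _ (fun x => x `^ a / a))//.
- by rewrite powR1 -EFinB; congr (_%:E); ring.
- apply: continuous_in_subspaceT => x; rewrite mem_setE in_itv/= => /andP[ex _].
  by apply: continuous_powR; exact: lt_le_trans ex.
- have cont x : 0 < x -> {for x, continuous (fun x => x `^ a / a)}.
    by move=> x0; apply: continuousM; [exact: continuous_powR|exact: cst_continuous].
  split.
  + move=> x; rewrite in_itv/= => /andP[ex _].
    have [dx _] := @is_derive1_powR R a _ (lt_trans e0 ex).
    by apply: derivableM => //.
  + by apply: cvg_at_right_filter; apply: cont.
  + by apply: cvg_at_left_filter; apply: cont.
- move=> x; rewrite in_itv/= => /andP[ex _].
  have x0 := lt_trans e0 ex.
  rewrite derive1E.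
  have := @is_derive1_powR R a _ x0 => -[dx dE].
  rewrite deriveM//= derive_cst scaler0 add0r dE.
  rewrite -[LHS]/(a^-1 * (a * _)) mulrA mulVf ?mul1r// gt_eqF//.
Qed.

(** The antiderivative x^a / a is differentiable only away from 0, whence the
    exhaustion of ]0, 1] by the segments [1 / (n + 2), 1]; the integrals over
    them are at most 1 / a. *)
Lemma integral_powR_lty (a : R) : 0 < a ->
  (\int[mu]_(x in `]0%R, 1%R]) (x `^ (a - 1)%R)%:E < +oo)%E.
Proof.
move=> a0; pose F (n : nat) : set R := `[n.+2%:R^-1, 1]%classic.
have cover (x : R) : 0 < x -> x <= 1 -> (\bigcup_n F n) x.
  move=> x0 x1; exists (Num.bound x^-1) => //.
  rewrite /F /= in_itv/= x1 andbT invf_ple ?posrE//; apply: ltW.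
  have xV0 : 0 <= x^-1 by rewrite invr_ge0 ltW.
  by rewrite (lt_le_trans (archi_boundP xV0))// ler_nat (leq_trans (leqnSn _)).
have -> : [set` `]0%R, (1 : R)]] = \bigcup_n F n.
  apply/seteqP; split=> [x /andP[x0 x1]|x [n _]]; first exact: cover.
  rewrite /F/= !in_itv/= => /andP[nx ->]; rewrite andbT.
  by apply: lt_le_trans nx; rewrite invr_gt0.
have mp n : measurable_fun (F n) (fun x : R => (x `^ (a - 1)%R)%:E).
  by apply: measurable_funTS; apply/measurable_EFinP.
have ndF : nondecreasing_seq F.
  move=> m n mn; apply/subsetPset => x; rewrite /F/= !in_itv/= => /andP[+ ->].
  by rewrite andbT; apply: le_trans; rewrite lef_pV2 ?posrE// ler_nat.
have mF n : measurable (F n) by exact: measurable_itv.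
have p0 n x : F n x -> (0 <= (x `^ (a - 1)%R)%:E)%E by rewrite lee_fin powR_ge0.
have cv : (\int[mu]_(x in F i) (x `^ (a - 1)%R)%:E @[i --> \oo] -->
    \int[mu]_(x in \bigcup_i F i) (x `^ (a - 1)%R)%:E)%E.
  exact: ge0_nondecreasing_set_cvg_integral.
rewrite -(cvg_lim _ cv)//.
apply: (@le_lt_trans _ _ (a^-1)%:E); last exact: ltry.
apply: lime_le; first by apply/cvg_ex; eexists; exact: cv.
apply: nearW => n; rewrite integral_powR_itv// ?invr_gt0// ?invf_lt1 ?ltr1n//.
by rewrite lee_fin ler_pdivrMr// mulVf ?gt_eqF// gerBl powR_ge0.
Qed.

(** Up to 1 the integrand is at most x^(a-1).  Beyond 1 one has
    x^(a-1) <= x^(N+1) <= C e^(x/2), which leaves e^(-x/2), a multiple of an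
    exponential density. *)
Lemma gamma_lty (a : R) : 0 < a ->
  (\int[mu]_(x in `]0%R, +oo[) (gamma_integrand a x)%:E < +oo)%E.
Proof.
move=> a0.
have mg D : measurable_fun D (EFin \o gamma_integrand a).
  by apply: measurable_funTS; apply/measurable_EFinP; exact: measurable_gamma_integrand.
rewrite (@itv_bndbnd_setU _ _ _ (BRight 1)) ?bnd_simp//.
rewrite ge0_integral_setU//=; last 3 first.
- exact: mg.
- by move=> x _; rewrite lee_fin gamma_integrand_ge0.
- apply/disj_setPS => x -[/andP[_ x1] /andP[x2 _]].
  by have := lt_le_trans (x2 : 1 < (x : R)) x1; rewrite ltxx.
rewrite lte_add_pinfty//.
  apply: le_lt_trans (integral_powR_lty _ a0); apply: ge0_le_integral => //=.
  - by move=> x _; rewrite lee_fin gamma_integrand_ge0.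
  - exact: mg.
  - by apply: measurable_funTS; apply/measurable_EFinP.
  - move=> x /andP[]; rewrite bnd_simp => x0 _; rewrite lee_fin /gamma_integrand.
    by rewrite ler_piMr ?powR_ge0// expR_le1 oppr_le0 ltW.
pose N := Num.bound a.
have aN : a - 1 <= N.+1%:R.
  have := archi_boundP (ltW a0); rewrite -/N -natr1; lra.
(* C comes from (x / 2)^(N+1) / (N+1)! <= e^(x / 2) *)
pose C : R := 2 ^+ N.+1 * N.+1`!%:R.
have C0 : 0 <= 2 * C by rewrite mulr_ge0// mulr_ge0// exprn_ge0.
apply: (@le_lt_trans _ _ (\int[mu]_x ((2 * C)%:E * (exponential_pdf 2^-1 x)%:E))%E).
  rewrite integral_mkcond; apply: ge0_le_integral => //=.
  - by move=> x _; apply: erestrict_ge0 => y _; rewrite lee_fin gamma_integrand_ge0.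
  - by apply/(measurable_restrictT _ _).1 => //; exact: mg.
  - apply: measurable_funeM; apply/measurable_EFinP.
    by apply: measurable_exponential_pdf.
  - move=> x' _; set x : R := x'; rewrite patchE mem_setE in_itv/= andbT.
    case: ifPn => x1; last first.
      by rewrite -EFinM lee_fin mulr_ge0// exponential_pdf_ge0// invr_ge0.
    rewrite -EFinM lee_fin exponential_pdfE ?(ltW (lt_trans _ x1))//.
    rewrite /gamma_integrand.
    rewrite (_ : - x = x / -2 + x / -2); last by field.
    rewrite expRD mulrA (_ : 2 * C * _ = C * expR (x / -2)); last first.
      by rewrite (_ : x / -2 = - 2^-1 * x); field.
    rewrite ler_pM2r ?expR_gt0//.
    have xp : x `^ (a - 1) <= x ^+ N.+1.
      by rewrite -powR_mulrn ?(ltW (lt_trans _ x1))//; apply: ler_powR => //; exact: ltW.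
    have x20 : 0 <= x / 2 by rewrite divr_ge0 ?(ltW (lt_trans _ x1)).
    have := expR_ge1Dxn N x20.
    have -> : x / -2 = - (x / 2) by field.
    rewrite expRN ler_pdivrMr ?expR_gt0// => he.
    apply: (le_trans xp).
    have : (x / 2) ^+ N.+1 / N.+1`!%:R <= expR (x / 2) by apply: le_trans he; rewrite lerDr.
    rewrite ler_pdivrMr ?ltr0n ?fact_gt0// expr_div_n ler_pdivrMr ?exprn_gt0//.
    rewrite (_ : C * _ = expR (x / 2) * N.+1`!%:R * 2 ^+ N.+1)//.
    by rewrite /C mulrC [2 ^+ _ * _]mulrC mulrA.
have h2 : 0 < 2^-1 :> R by [].
rewrite ge0_integralZl//; last 2 first.
- apply/measurable_EFinP; exact: measurable_exponential_pdf.
- by move=> x _; rewrite lee_fin exponential_pdf_ge0// invr_ge0.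
by rewrite integral_exponential_pdf// mule1 ltry.
Qed.

Lemma gamma_funE (a : R) : 0 < a ->
  ((gamma_fun a)%:E = \int[mu]_(x in `]0%R, +oo[) (gamma_integrand a x)%:E)%E.
Proof.
move=> a0; rewrite /gamma_fun /Rintegral fineK// ge0_fin_numE; first exact: gamma_lty.
by apply: integral_ge0 => x _; rewrite lee_fin gamma_integrand_ge0.
Qed.

(** Keep only the part of the integral over [M, M + 1], which has length 1. *)
Lemma gamma_fun_ge_cst (a M c : R) : 0 < a -> 0 < M -> 0 <= c ->
  (forall x, M <= x <= M + 1 -> c <= gamma_integrand a x) -> c <= gamma_fun a.
Proof.
move=> a0 M0 c0 cg; rewrite -lee_fin gamma_funE//.
have mg D : measurable_fun D (EFin \o gamma_integrand a).
  by apply: measurable_funTS; apply/measurable_EFinP; exact: measurable_gamma_integrand.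
apply: (@le_trans _ _ (\int[mu]_(x in `[M, (M + 1)%R]) (gamma_integrand a x)%:E)%E); last first.
  apply: ge0_subset_integral => //; first exact: mg.
    by move=> x _; rewrite lee_fin gamma_integrand_ge0.
  by apply: subset_itv; rewrite bnd_simp.
apply: (@le_trans _ _ (\int[mu]_(x in `[M, (M + 1)%R]) c%:E)%E).
  rewrite integral_cst//= lebesgue_measure_itv/= lte_fin ltrDl ltr01.
  by rewrite -EFinB addrAC subrr add0r mule1.
by apply: ge0_le_integral => //; exact: mg.
Qed.

Lemma gamma_fun_gt0 (a : R) : 0 < a -> 0 < gamma_fun a.
Proof.
move=> a0; apply: (@lt_le_trans _ _ (2^-1 * expR (-2))).
  by rewrite mulr_gt0// expR_gt0.
apply: (@gamma_fun_ge_cst a 1) => //.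
move=> x /andP[x1 x2]; rewrite /gamma_integrand.
apply: ler_pM => //; last by rewrite ler_expR lerN2.
have x0 : 0 < x by exact: lt_le_trans x1.
apply: (@le_trans _ _ (x `^ (-1))); last by apply: ler_powR => //; lra.
by rewrite powR_inv1 ?(ltW x0)// lef_pV2 ?posrE.
Qed.

(** As M is arbitrary, Gamma outgrows every geometric sequence. *)
Lemma gamma_fun_geX (x M : R) : 0 <= x -> 0 < M ->
  M `^ x * expR (- (M + 1)) <= gamma_fun (x + 1).
Proof.
move=> x0 M0; apply: (@gamma_fun_ge_cst (x + 1) M) => //.
- by rewrite ltr_wpDl.
- by rewrite mulr_ge0 ?powR_ge0 ?expR_ge0.
move=> y /andP[My yM]; rewrite /gamma_integrand addrK.
apply: ler_pM; rewrite ?powR_ge0 ?expR_ge0 ?ler_expR ?lerN2//.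
by apply: ge0_ler_powR => //; rewrite nnegrE ltW// (lt_le_trans M0).
Qed.

Lemma gamma_fun1 : gamma_fun 1 = 1 :> R.
Proof.
apply: EFin_inj; rewrite gamma_funE//.
have h1 : 0 < 1 :> R by [].
rewrite -(integral_exponential_pdf h1) [RHS](_ : _ =
    \int[mu]_(x in `[0%R, +oo[) (gamma_integrand 1 x)%:E)%E.
  apply: integral_itv_obnd_cbnd; apply: measurable_funTS.
  by apply/measurable_EFinP; exact: measurable_gamma_integrand.
rewrite [RHS]integral_mkcond; apply: eq_integral => x _.
rewrite /exponential_pdf !patchE; case: ifPn => // _.
by rewrite /gamma_integrand subrr powRr0 mulN1r.
Qed.

(** Convolution with this kernel is the Riemann-Liouville integral of order a. *)
Definition frac_kernel (a x : R) : R := x `^ (a - 1) / gamma_fun a.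

Lemma frac_kernel_ge0 (a s : R) : 0 < a -> 0 <= frac_kernel a s.
Proof. by move=> a0; rewrite divr_ge0 ?powR_ge0// ltW// gamma_fun_gt0. Qed.

Lemma bounded_frac_kernel (a t : R) : 1 <= a -> bounded_upto t (frac_kernel a).
Proof.
move=> a1; have a0 : 0 < a by exact: lt_le_trans a1.
exists (frac_kernel a t) => s /andP[s0 st].
rewrite ger0_norm ?frac_kernel_ge0// ler_pM2r ?invr_gt0 ?gamma_fun_gt0//.
by apply: ge0_ler_powR; rewrite ?nnegrE ?subr_ge0// (le_trans s0 st).
Qed.

Lemma measurable_frac_kernel a : measurable_fun setT (frac_kernel a).
Proof. exact: measurable_funM. Qed.

(** On [0, t] the factor e^(-x) of the Gamma integrand is at least e^(-t), so
    the convergence of Gamma gives the local integrability of the power. *)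
Lemma integrable_frac_kernel (a t : R) : 0 < a ->
  mu.-integrable `[0, t] (EFin \o frac_kernel a).
Proof.
move=> a0; have mf : measurable_fun setT (EFin \o frac_kernel a).
  by apply/measurable_EFinP; exact: measurable_frac_kernel.
apply/integrableP; split; first exact: measurable_funTS.
rewrite integral_itv_bndoo; last first.
  by apply: measurableT_comp => //; exact: measurable_funTS.
have mg D : measurable_fun D (EFin \o gamma_integrand a).
  by apply: measurable_funTS; apply/measurable_EFinP; exact: measurable_gamma_integrand.
pose C := expR t / gamma_fun a.
have C0 : 0 <= C by rewrite divr_ge0 ?expR_ge0// ltW// gamma_fun_gt0.
apply: (@le_lt_trans _ _ (\int[mu]_(x in `]0%R, t[) (C%:E * (gamma_integrand a x)%:E))%E).
  apply: ge0_le_integral => //.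
  - by apply: measurableT_comp => //; exact: measurable_funTS.
  - by apply: measurable_funeM; exact: mg.
  move=> x /andP[]; rewrite !bnd_simp => x0 xt.
  have p0 : 0 <= frac_kernel a x by rewrite divr_ge0 ?powR_ge0// ltW// gamma_fun_gt0.
  have ex1 : 1 <= expR t * expR (- x).
    by rewrite -expRD -[leLHS]expR0 ler_expR subr_ge0 ltW.
  rewrite -EFinM abse_EFin lee_fin ger0_norm//.
  rewrite (_ : C * _ = frac_kernel a x * (expR t * expR (- x))); first by rewrite ler_peMr.
  by rewrite /C /frac_kernel /gamma_integrand; ring.
rewrite ge0_integralZl//; last 2 first.
- exact: mg.
- by move=> x _; rewrite lee_fin gamma_integrand_ge0.
apply: lte_mul_pinfty => //.
apply: le_lt_trans (gamma_lty _ a0); apply: ge0_subset_integral => //.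
- exact: mg.
- by move=> x _; rewrite lee_fin gamma_integrand_ge0.
- by apply: subset_itvl.
Qed.

Definition gamma_density (a : R) : R -> R := gamma_integrand a \_ `]0, +oo[.

Lemma measurable_gamma_density a : measurable_fun setT (gamma_density a).
Proof.
apply/(measurable_restrictT _ _).1 => //; apply: measurable_funTS.
exact: measurable_gamma_integrand.
Qed.

Lemma gamma_density_ge0 a x : 0 <= gamma_density a x.
Proof. by rewrite /gamma_density; apply: restrict_ge0 => y _; exact: gamma_integrand_ge0. Qed.

Lemma gamma_densityE a x : 0 < x -> gamma_density a x = gamma_integrand a x.
Proof. by move=> x0; rewrite /gamma_density patchE mem_setE in_itv/= x0. Qed.

Lemma gamma_density_le0 a x : x <= 0 -> gamma_density a x = 0.
Proof. by move=> x0; rewrite /gamma_density patchE mem_setE in_itv/= ltNge x0. Qed.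

Lemma integral_gamma_density a : 0 < a ->
  (\int[mu]_x (gamma_density a x)%:E = (gamma_fun a)%:E)%E.
Proof.
move=> a0; rewrite gamma_funE// [RHS]integral_mkcond.
by apply: eq_integral => x _; rewrite /gamma_density !patchE; case: ifP.
Qed.

(** Euler's Beta function.  It is extended-real because its finiteness comes
    out of the computation of [beta_gamma]. *)
Definition beta_integral (a b : R) : \bar R :=
  (\int[mu]_x (((fun y : R => (1 - y) `^ (a - 1) * y `^ (b - 1)) \_ `]0%R, 1%R[) x)%:E)%E.

Lemma beta_integral_ge0 a b : (0 <= beta_integral a b)%E.
Proof.
apply: integral_ge0 => x _; rewrite lee_fin; apply: restrict_ge0 => y _.
by rewrite mulr_ge0 ?powR_ge0.
Qed.

(** Substitute s = t x: the exponentials multiply to e^(-t), and the powers of t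
    to t^(a+b-1). *)
Lemma convolution_gamma_density (a b t : R) : 0 < a -> 0 < b ->
  (\int[mu]_s (gamma_density a (t - s) * gamma_density b s)%:E =
   (gamma_density (a + b) t)%:E * beta_integral a b)%E.
Proof.
move=> a0 b0; have [t0|t0] := leP t 0.
  rewrite gamma_density_le0// mul0e integral0_eq// => s _.
  have [s0|s0] := leP s 0; first by rewrite (gamma_density_le0 b s)// mulr0.
  by rewrite (gamma_density_le0 a)// ?mul0r// subr_le0 (le_trans t0)// ltW.
have mU : measurable_fun setT ((fun y : R => (1 - y) `^ (a - 1) * y `^ (b - 1)) \_ `]0, 1[).
  apply/(measurable_restrictT _ _).1 => //; apply: measurable_funTS.
  apply: measurable_funM => //.
  apply: (measurableT_comp (measurable_powR _)) => //; exact: measurable_funB.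
have tn0 : t != 0 by rewrite gt_eqF.
rewrite (ge0_integral_affine t 0 _ tn0); last 2 first.
- apply/measurable_EFinP; apply: measurable_funM; last exact: measurable_gamma_density.
  apply: (measurableT_comp (measurable_gamma_density _)) => //; exact: measurable_funB.
- by move=> x; rewrite lee_fin mulr_ge0// gamma_density_ge0.
rewrite /beta_integral -[RHS]ge0_integralZl//=; last 3 first.
- exact/measurable_EFinP.
- move=> x _; rewrite lee_fin; apply: restrict_ge0 => y _.
  by rewrite mulr_ge0 ?powR_ge0.
- by rewrite lee_fin gamma_density_ge0.
rewrite -[LHS]ge0_integralZl//=; last 2 first.
- apply/measurable_EFinP; apply: measurable_funM.
    apply: (measurableT_comp (measurable_gamma_density _)) => //.
    by apply: measurable_funB => //; apply: measurable_funD.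
  by apply: (measurableT_comp (measurable_gamma_density _)) => //; apply: measurable_funD.
- by move=> x _; rewrite lee_fin mulr_ge0// gamma_density_ge0.
apply: eq_integral => x' _; set x : R := x'; rewrite -!EFinM; congr (_%:E).
rewrite patchE mem_setE in_itv/= addr0 gtr0_norm//.
case: ifPn => [/andP[x0 x1]|].
  rewrite !gamma_densityE//; last 2 first.
  - by rewrite mulr_gt0.
  - by rewrite subr_gt0 gtr_pMr.
  rewrite /gamma_integrand (_ : t - t * x = t * (1 - x)); last by ring.
  have x10 : 0 < 1 - x by rewrite subr_gt0.
  have -> : t `^ (a + b - 1) = t * t `^ (a - 1) * t `^ (b - 1).
    rewrite (_ : a + b - 1 = 1 + ((a - 1) + (b - 1))); last by ring.
    have tD r s : t `^ (r + s) = t `^ r * t `^ s by rewrite powRD// tn0 implybT.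
    by rewrite (tD 1) (tD (a - 1)) powRr1 ?ltW// mulrA.
  rewrite !powRM// ?ltW//.
  rewrite (_ : - t = - (t * (1 - x)) - (t * x)); last by ring.
  by rewrite expRD; ring.
rewrite negb_and -!leNgt => /orP[x0|x1].
  by rewrite (gamma_density_le0 b) ?mulr0// pmulr_rle0.
by rewrite (gamma_density_le0 a) ?(mul0r,mulr0)// subr_le0 ler_peMr// ltW.
Qed.

(** Integrate [convolution_gamma_density] over t: by Tonelli and translation
    invariance the left-hand side becomes Gamma(a) Gamma(b). *)
Lemma beta_gamma (a b : R) : 0 < a -> 0 < b ->
  beta_integral a b = (gamma_fun a * gamma_fun b / gamma_fun (a + b))%:E.
Proof.
move=> a0 b0; have ab0 : 0 < a + b by rewrite addr_gt0.
suff : ((gamma_fun a * gamma_fun b)%:E = (gamma_fun (a + b))%:E * beta_integral a b)%E.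
  have := beta_integral_ge0 a b; case: (beta_integral a b) => [r|//|//] _.
    by move=> [->]; congr (_%:E); field; rewrite gt_eqF// gamma_fun_gt0.
  by rewrite gt0_muley ?lte_fin ?gamma_fun_gt0.
pose K (z : R * R) : \bar R := (gamma_density a (z.1 - z.2) * gamma_density b z.2)%:E.
have mK : measurable_fun setT K.
  apply/measurable_EFinP; apply: measurable_funM.
    apply: (measurableT_comp (measurable_gamma_density _)) => //; exact: measurable_funB.
  exact: (measurableT_comp (measurable_gamma_density _)).
have K0 z : (0 <= K z)%E by rewrite lee_fin mulr_ge0// gamma_density_ge0.
have := @fubini_tonelli _ _ _ _ R mu mu K mK K0.
under [X in X = _ -> _]eq_integral do rewrite /K/= convolution_gamma_density//.
rewrite ge0_integralZr//; last 3 first.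
- by apply/measurable_EFinP; exact: measurable_gamma_density.
- by move=> x _; rewrite lee_fin gamma_density_ge0.
- exact: beta_integral_ge0.
rewrite integral_gamma_density// => ->.
have inner s : (\int[mu]_x K (x, s) = (gamma_fun a)%:E * (gamma_density b s)%:E)%E.
  have mg : measurable_fun setT (EFin \o gamma_density a).
    by apply/measurable_EFinP; exact: measurable_gamma_density.
  have shift := ge0_integral_affine 1 (- s) (EFin \o gamma_density a) (oner_neq0 _) mg
    (fun x => gamma_density_ge0 a x).
  rewrite normr1 mul1e in shift.
  transitivity (\int[mu]_x ((gamma_density a (1 * x + - s))%:E * (gamma_density b s)%:E))%E.
    by apply: eq_integral => x _; rewrite /K mul1r EFinM.
  rewrite ge0_integralZr//.
  - by rewrite -shift integral_gamma_density.
  - apply/measurable_EFinP; apply: (measurableT_comp (measurable_gamma_density _)) => //.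
    exact: measurable_funD.
  - by move=> x _; rewrite lee_fin gamma_density_ge0.
  - by rewrite lee_fin gamma_density_ge0.
under eq_integral do rewrite inner.
rewrite ge0_integralZl//.
- by rewrite integral_gamma_density.
- by apply/measurable_EFinP; exact: measurable_gamma_density.
- by move=> x _; rewrite lee_fin gamma_density_ge0.
- by rewrite lee_fin ltW// gamma_fun_gt0.
Qed.

(** The convolution of the kernels is e^t / (Gamma(a) Gamma(b)) times the
    convolution of the Gamma densities. *)
Lemma frac_kernel_semigroup (a b t : R) : 0 < a -> 0 < b -> 0 < t ->
  convol (frac_kernel a) (frac_kernel b) t = frac_kernel (a + b) t.
Proof.
move=> a0 b0 t0; have ab0 : 0 < a + b by rewrite addr_gt0.
have ga := gamma_fun_gt0 _ a0; have gb := gamma_fun_gt0 _ b0.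
have gab := gamma_fun_gt0 _ ab0.
apply: EFin_inj; rewrite /convol /Rintegral integral_itv_bndoo; last first.
  apply/measurable_EFinP; apply: measurable_funTS; apply: measurable_funM.
    apply: (measurableT_comp (measurable_frac_kernel _)) => //; exact: measurable_funB.
  exact: measurable_frac_kernel.
rewrite integral_mkcond.
pose c := expR t / (gamma_fun a * gamma_fun b).
have c0 : 0 <= c := divr_ge0 (expR_ge0 t) (ltW (mulr_gt0 ga gb)).
transitivity (fine (\int[mu]_s (c%:E * (gamma_density a (t - s) * gamma_density b s)%:E)))%:E.
  congr (fine _)%:E; apply: eq_integral => s' _; set s : R := s'.
  rewrite patchE mem_setE in_itv/= -EFinM.
  case: ifPn => [/andP[s0 st]|].
    rewrite !gamma_densityE ?subr_gt0// /frac_kernel /gamma_integrand /c.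
    congr (_%:E); rewrite (_ : expR t = (expR (- (t - s)) * expR (- s))^-1); last first.
      by rewrite -expRD -expRN; congr expR; ring.
    move: (expR_gt0 (- (t - s))) (expR_gt0 (- s)) ga gb.
    move: (expR _) (expR _) (gamma_fun a) (gamma_fun b) => e1 e2 A A' e10 e20 A0 A'0.
    by field; rewrite !gt_eqF.
  rewrite negb_and -!leNgt => /orP[s0|ts].
    by rewrite (gamma_density_le0 b)// !mulr0.
  by rewrite (gamma_density_le0 a) ?subr_le0// mul0r mulr0.
rewrite ge0_integralZl//; last 2 first.
- apply/measurable_EFinP; apply: measurable_funM; last exact: measurable_gamma_density.
  apply: (measurableT_comp (measurable_gamma_density _)) => //; exact: measurable_funB.
- by move=> s _; rewrite lee_fin mulr_ge0// gamma_density_ge0.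
rewrite convolution_gamma_density// beta_gamma// -!EFinM /=.
rewrite gamma_densityE// /frac_kernel /gamma_integrand /c expRN; congr (_%:E).
move: (expR_gt0 t) ga gb gab.
move: (expR _) (gamma_fun a) (gamma_fun b) (gamma_fun _) => e A A' A'' e0 A0 A'0 A''0.
by field; rewrite !gt_eqF.
Qed.

End gamma.

(** * The Mittag-Leffler kernel *)

Section mittag_leffler.
Context {R : realType}.
Local Notation mu := (@lebesgue_measure R).

Variable alpha : R.
Hypothesis alpha0 : 0 < alpha.

Definition ml_coeff (z : R) (n : nat) : R := z ^+ n / gamma_fun (n%:R * alpha + 1).

Lemma ml_arg_gt0 (n : nat) : 0 < n%:R * alpha + 1.
Proof. by rewrite ltr_wpDl// mulr_ge0// ltW. Qed.

(** In [gamma_fun_geX] take M with M^alpha = 2 Z + 1: the n-th term is then at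
    most e^(M+1) (Z / (2 Z + 1))^n. *)
Lemma ml_coeff_bound (Z : R) : 0 <= Z -> exists2 C : R, 0 <= C &
  forall z n, `|z| <= Z -> `|ml_coeff z n| <= C * 2^-1 ^+ n.
Proof.
move=> Z0; pose Y := 2 * Z + 1; have Y0 : 0 < Y by rewrite ltr_wpDl// mulr_ge0.
pose M := Y `^ alpha^-1; have M0 : 0 < M by rewrite powR_gt0.
exists (expR (M + 1)); first exact: expR_ge0.
move=> z n zZ; have G0 := gamma_fun_gt0 _ (ml_arg_gt0 n).
rewrite normrM normrX normfV (gtr0_norm G0) ler_pdivrMr//.
have na0 : 0 <= n%:R * alpha by rewrite mulr_ge0// ltW.
have := gamma_fun_geX _ _ na0 M0.
have -> : M `^ (n%:R * alpha) = Y ^+ n.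
  rewrite /M -powRrM mulrCA mulVf ?gt_eqF// mulr1 powR_mulrn// ltW//.
move=> gM; apply: (@le_trans _ _ (expR (M + 1) * 2^-1 ^+ n * (Y ^+ n * expR (- (M + 1))))).
  rewrite (_ : _ * _ = (2^-1 * Y) ^+ n * (expR (M + 1) * expR (- (M + 1)))); last first.
    by rewrite exprMn; ring.
  have zY : `|z| <= 2^-1 * Y by apply: (le_trans zZ); rewrite /Y; lra.
  rewrite expRxMexpNx_1 mulr1; apply: lerXn2r; rewrite ?nnegrE//.
  by rewrite (le_trans _ zY).
by apply: ler_wpM2l => //; rewrite mulr_ge0 ?expR_ge0.
Qed.

Lemma ml_cvg (z : R) : series (ml_coeff z) @ \oo --> mittag_leffler alpha z.
Proof.
apply: (@normed_cvg R R^o).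
have [C C0 Cz] := @ml_coeff_bound `|z| (normr_ge0 _).
apply: (@series_le_cvg _ _ (geometric C 2^-1)) => //.
- by move=> n; exact: normr_ge0.
- by move=> n; rewrite /= mulr_ge0// exprn_ge0.
- by move=> n; exact: Cz.
- by apply: is_cvg_geometric_series; rewrite ger0_norm// invf_lt1// ltr1n.
Qed.

(** The bound does not depend on the number of terms; this is the domination
    under which the series is integrated termwise. *)
Lemma ml_series_bound (Z : R) : 0 <= Z -> exists2 C : R, 0 <= C &
  forall z n, `|z| <= Z -> `|series (ml_coeff z) n| <= C.
Proof.
move=> Z0; have [C C0 Cz] := ml_coeff_bound _ Z0.
exists (2 * C); first by rewrite mulr_ge0.
move=> z n zZ; apply: (@le_trans _ _ (2 * C * (1 - 2^-1 ^+ n))); last first.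
  by rewrite ler_piMr ?mulr_ge0// gerBl exprn_ge0.
elim: n => [|n ih]; first by rewrite /series/= big_geq// normr0 expr0 subrr mulr0.
rewrite /series/= big_nat_recr//=.
apply: (le_trans (ler_normD _ _)); apply: (le_trans (lerD ih (Cz z n zZ))).
by rewrite exprS; lra.
Qed.

Lemma ml_bound (Z : R) : 0 <= Z -> exists2 C : R, 0 <= C &
  forall z, `|z| <= Z -> `|mittag_leffler alpha z| <= C.
Proof.
move=> Z0; have [C C0 Cz] := ml_series_bound _ Z0; exists C => // z zZ.
have zcvg : cvgn (series (ml_coeff z)) by apply/cvg_ex; eexists; exact: ml_cvg.
rewrite ler_norml; apply/andP; split.
  apply: limr_ge => //; apply: nearW => n.
  by have := Cz z n zZ; rewrite ler_norml => /andP[].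
apply: limr_le => //; apply: nearW => n.
by have := Cz z n zZ; rewrite ler_norml => /andP[].
Qed.

Variable k : R.
Hypothesis k0 : 0 <= k.

Definition ml_kernel (s : R) : R := mittag_leffler alpha (- k * s `^ alpha).

Definition ml_kernel_partial (n : nat) (s : R) : R :=
  series (ml_coeff (- k * s `^ alpha)) n.

Lemma ml_kernel_arg (t s : R) : 0 <= s <= t -> `|- k * s `^ alpha| <= k * t `^ alpha.
Proof.
move=> /andP[s0 st]; rewrite normrM normrN (ger0_norm k0) (ger0_norm (powR_ge0 _ _)).
apply: ler_wpM2l => //; apply: ge0_ler_powR; rewrite ?nnegrE// ?(ltW alpha0)//.
exact: le_trans st.
Qed.

Lemma ml_coeffE (s : R) n : 0 <= s ->
  ml_coeff (- k * s `^ alpha) n = (- k) ^+ n * frac_kernel (n%:R * alpha + 1) s.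
Proof.
move=> s0; rewrite /ml_coeff /frac_kernel exprMn addrK -mulrA; congr (_ * (_ / _)).
by rewrite -powR_mulrn ?powR_ge0// -powRrM mulrC.
Qed.

Lemma measurable_ml_kernel_partial n : measurable_fun setT (ml_kernel_partial n).
Proof.
apply: measurable_sum => i; apply: measurable_funM => //; apply: measurable_funX.
exact: measurable_funM.
Qed.

Lemma measurable_ml_kernel : measurable_fun setT ml_kernel.
Proof.
apply: (@measurable_fun_cvg _ _ _ _ ml_kernel_partial).
  by move=> n; exact: measurable_ml_kernel_partial.
by move=> x _; exact: ml_cvg.
Qed.

Lemma bounded_ml_kernel t : bounded_upto t ml_kernel.
Proof.
have [|C C0 Cz] := @ml_bound (k * t `^ alpha); first by rewrite mulr_ge0 ?powR_ge0.
by exists C => s st; apply: Cz; exact: ml_kernel_arg.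
Qed.

Lemma integrable_ml_kernel t : mu.-integrable `[0, t] (EFin \o ml_kernel).
Proof.
apply: bounded_upto_integrable; last exact: bounded_ml_kernel.
by apply: measurable_funTS; exact: measurable_ml_kernel.
Qed.

End mittag_leffler.

Section resolvent.
Context {R : realType}.
Local Notation mu := (@lebesgue_measure R).

Variables alpha k : R.
Hypothesis alpha0 : 0 < alpha.
Hypothesis k0 : 0 <= k.
Local Notation p := (frac_kernel alpha).
Local Notation E := (ml_kernel alpha k).
Local Notation S := (ml_kernel_partial alpha k).

Lemma ml_kernel_partialS n s : S n.+1 s = S n s + ml_coeff alpha (- k * s `^ alpha) n.
Proof. by rewrite /ml_kernel_partial /series/= big_nat_recr. Qed.

Lemma bounded_ml_coeff t n : bounded_upto t (fun s => ml_coeff alpha (- k * s `^ alpha) n).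
Proof.
have [|C C0 Cz] := ml_coeff_bound _ alpha0 (k * t `^ alpha).
  by rewrite mulr_ge0 ?powR_ge0.
by exists (C * 2^-1 ^+ n) => s st; apply: Cz; exact: ml_kernel_arg.
Qed.

Lemma bounded_ml_kernel_partial t : exists2 C : R, 0 <= C &
  forall n s, 0 <= s <= t -> `|S n s| <= C.
Proof.
have [|C C0 Cz] := ml_series_bound _ alpha0 (k * t `^ alpha).
  by rewrite mulr_ge0 ?powR_ge0.
by exists C => // n s st; apply: Cz; exact: ml_kernel_arg.
Qed.

(** By the semigroup law, convolution with k p_alpha sends each term of the
    series to minus the next one. *)
Lemma convol_frac_ml_kernel_partial n t : 0 < t ->
  k * convol p (S n) t = 1 - S n.+1 t.
Proof.
move=> t0; elim: n => [|n ih].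
  rewrite ml_kernel_partialS /ml_kernel_partial /series/= big_geq// add0r.
  rewrite /ml_coeff expr0 mul0r add0r gamma_fun1 invr1 mulr1 subrr.
  rewrite (_ : convol _ _ _ = 0) ?mulr0//.
  rewrite /convol (@eq_Rintegral _ _ _ _ _ (cst 0)) ?Rintegral_cst ?mul0r//.
  by move=> s _; rewrite big_geq// mulr0.
have ip := integrable_frac_kernel alpha t alpha0.
have mc : measurable_fun setT (fun s => ml_coeff alpha (- k * s `^ alpha) n).
  by apply: measurable_funM => //; apply: measurable_funX; exact: measurable_funM.
have ic : mu.-integrable `[0, t] (EFin \o (fun s => ml_coeff alpha (- k * s `^ alpha) n)).
  by apply: bounded_upto_integrable; [exact: measurable_funTS|exact: bounded_ml_coeff].
have [C C0 SC] := bounded_ml_kernel_partial t.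
have bS : bounded_upto t (S n) by exists C => s; exact: SC.
have iS : mu.-integrable `[0, t] (EFin \o S n).
  apply: bounded_upto_integrable => //; apply: measurable_funTS.
  exact: measurable_ml_kernel_partial.
have -> : S n.+1 = (fun s => S n s + ml_coeff alpha (- k * s `^ alpha) n).
  by apply/funext => s; rewrite ml_kernel_partialS.
rewrite convolDr//; [|by right|by right; exact: bounded_ml_coeff].
rewrite mulrDr ih (ml_kernel_partialS n.+1).
rewrite ml_coeffE// ?ltW//.
rewrite (_ : convol p _ t = convol p (fun s => (- k) ^+ n * frac_kernel (n%:R * alpha + 1) s) t).
  have iN := integrable_frac_kernel (n%:R * alpha + 1) t (ml_arg_gt0 _ alpha0 n).
  have bN : bounded_upto t (frac_kernel (n%:R * alpha + 1)).
    by apply: bounded_frac_kernel; rewrite lerDr mulr_ge0// ltW.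
  rewrite (convolZr _ _ ((- k) ^+ n) _ ip iN (or_intror bN)).
  rewrite frac_kernel_semigroup// ?ml_arg_gt0// (_ : alpha + _ = n.+1%:R * alpha + 1).
    by rewrite exprS; ring.
  by rewrite -natr1; ring.
apply: eq_Rintegral => s; rewrite inE/= in_itv/= => /andP[s0 _].
by rewrite ml_coeffE.
Qed.

(** The limit of [convol_frac_ml_kernel_partial]. *)
Lemma ml_kernel_resolvent t : 0 <= t -> E t + k * convol p E t = 1.
Proof.
rewrite le_eqVlt => /predU1P[<-|t0].
  (* at time 0 only the constant term 1 of the series is left *)
  rewrite /convol set_itv1 Rintegral_set1 mulr0 addr0 /ml_kernel.
  rewrite powR0 ?gt_eqF// mulr0; apply/cvg_lim => //.
  rewrite -(cvg_shiftS _); apply: cvg_near_cst; apply: nearW => n.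
  rewrite /series/= big_nat_recl//= big1 ?addr0.
    by rewrite /ml_coeff expr0 mul0r add0r gamma_fun1 invr1 mulr1.
  by move=> i _; rewrite /ml_coeff expr0n/= mul0r.
have ip := integrable_frac_kernel alpha t alpha0.
have [C C0 SC] := bounded_ml_kernel_partial t.
have cvgl : convol p (S n) t @[n --> \oo] --> convol p E t.
  apply: (@Rdominated_cvg R _ _ _ (fun s => frac_kernel alpha (t - s) * cst C s)) => //.
  - move=> n; apply: measurable_funTS; apply: measurable_funM.
      apply: (measurableT_comp (measurable_frac_kernel _)) => //; exact: measurable_funB.
    exact: measurable_ml_kernel_partial.
  - by move=> s _; apply: cvgM; [exact: cvg_cst|exact: ml_cvg].
  - have bC : bounded_upto t (cst C) by exists C => s _; rewrite /= ger0_norm.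
    apply: integrable_convol => //; last by right.
    by apply: bounded_upto_integrable => //; exact: measurable_funTS.
  - move=> n s /andP[]; rewrite !bnd_simp => s0 st.
    rewrite normrM (ger0_norm (frac_kernel_ge0 _ _ alpha0)).
    by apply: ler_wpM2l; [exact: frac_kernel_ge0|apply: SC; rewrite s0].
have cvg2 : 1 - S n.+1 t @[n --> \oo] --> 1 - E t.
  apply: cvgB; first exact: cvg_cst.
  have := @ml_cvg R alpha alpha0 (- k * t `^ alpha).
  by rewrite -(cvg_shiftS (series _)).
have cvg1 : k * convol p (S n) t @[n --> \oo] --> k * convol p E t.
  by apply: cvgM => //; exact: cvg_cst.
have -> : k * convol p E t = 1 - E t.
  have e : (fun n => k * convol p (S n) t) = (fun n => 1 - S n.+1 t).
    by apply/funext => n; exact: convol_frac_ml_kernel_partial.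
  by rewrite e in cvg1; exact: (cvg_unique _ cvg1 cvg2).
by rewrite addrC subrK.
Qed.

End resolvent.

(** * Smooth approximations of indicator functions *)

Section smoothstep.
Context {R : realType}.
Local Notation mu := (@lebesgue_measure R).
Implicit Types x y t : R.

Definition ramp x : R := Num.max x 0.
Definition ramp_sq x : R := ramp x ^+ 2.
Definition hat x : R := ramp x - 2 * ramp (x - 1) + ramp (x - 2).
(** A second difference of the C^1 function [ramp_sq]: it rises from 0 to 1 on
    [0, 2], with derivative the triangle function [hat]. *)
Definition smoothstep x : R :=
  (ramp_sq x - 2 * ramp_sq (x - 1) + ramp_sq (x - 2)) / 2.

(** At every point, the kink at 0 included, the linear approximation is exact up
    to h^2. *)
Lemma is_derive_ramp_sq x : is_derive x 1 ramp_sq (2 * ramp x).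
Proof.
have cv : h^-1 *: (ramp_sq (h *: (1 : R) + x) - ramp_sq x) @[h --> 0^'] --> 2 * ramp x.
  apply/cvgrPdist_le => e e0; near=> h.
  have h0 : h != 0 by near: h; exact: nbhs_dnbhs_neq.
  have he : `|h| <= e.
    near: h; apply: nbhs_dnbhs; apply/nbhs_ballP; exists e => // z.
    by rewrite /ball/= sub0r normrN => /ltW.
  apply: le_trans he; rewrite /GRing.scale/= mulr1.
  rewrite (_ : 2 * ramp x - _ =
    h^-1 * (2 * ramp x * h - (ramp_sq (h + x) - ramp_sq x))); last first.
    by field.
  rewrite normrM normfV ler_pdivrMl ?normr_gt0// -expr2 real_normK ?num_real//.
  rewrite /ramp_sq /ramp ler_norml; apply/andP; split;
    case: (leP x 0) => x0; case: (leP (h + x) 0) => hx; nra.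
by apply: DeriveDef; [apply/cvg_ex; eexists; exact: cv|exact/cvg_lim].
Unshelve. all: by end_near. Qed.

Lemma is_derive_comp_affine (f : R -> R) (r c x df : R) : is_derive (r * (x - c)) 1 f df ->
  is_derive x 1 (fun y => f (r * (y - c))) (r * df).
Proof.
move=> dff.
have dg : is_derive x 1 (fun y : R => r * (y - c)) r.
  rewrite (_ : (fun y : R => _) = r \*: (fun y : R => y - c)).
    by apply: is_derive_eq; rewrite subr0 /GRing.scale/= mulr1.
  by apply/funext => y.
by rewrite mulrC; exact: (@is_derive1_comp _ f _ x df r dff dg).
Qed.

Lemma is_derive_smoothstep x : is_derive x 1 smoothstep (hat x).
Proof.
have shift (c : R) : is_derive x 1 (fun y => ramp_sq (y - c)) (2 * ramp (x - c)).
  rewrite -[2 * _]mul1r (_ : (fun y => _) = (fun y => ramp_sq (1 * (y - c)))).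
    by apply: is_derive_comp_affine; rewrite mul1r; exact: is_derive_ramp_sq.
  by apply/funext => y; rewrite mul1r.
have d0 := is_derive_ramp_sq x; have d1 := shift 1; have d2 := shift 2.
rewrite (_ : smoothstep = (fun y =>
    2^-1 *: ((ramp_sq y - 2 *: ramp_sq (y - 1)) + ramp_sq (y - 2)))); last first.
  by apply/funext => y; rewrite /smoothstep /GRing.scale/= mulrC.
apply: is_derive_eq.
by rewrite /hat /GRing.scale/=; field.
Qed.

Lemma continuous_ramp : continuous (ramp : R -> R).
Proof.
move=> x; rewrite /ramp; apply: continuous_max => //.
exact: cst_continuous.
Qed.

Lemma continuous_hat : continuous hat.
Proof.
move=> x; have sh c : {for x, continuous (fun y => ramp (y - c))}.
  apply: (@continuous_comp _ _ _ (fun y => y - c) ramp); last exact: continuous_ramp.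
  by apply: continuousB; [exact: cvg_id|exact: cst_continuous].
rewrite /continuous_at /hat; apply: cvgD; last exact: sh.
apply: cvgB; first exact: continuous_ramp.
by apply: cvgM; [exact: cvg_cst|exact: sh].
Qed.

Lemma hat_ge0 x : 0 <= hat x.
Proof.
rewrite /hat /ramp.
by case: (leP x 0) => ?; case: (leP (x - 1) 0) => ?; case: (leP (x - 2) 0) => ?; lra.
Qed.

Lemma hat_le0 x : x <= 0 -> hat x = 0.
Proof.
move=> x0; rewrite /hat /ramp.
by case: (leP x 0) => ?; case: (leP (x - 1) 0) => ?; case: (leP (x - 2) 0) => ?; lra.
Qed.

Lemma hat_ge2 x : 2 <= x -> hat x = 0.
Proof.
move=> x0; rewrite /hat /ramp.
by case: (leP x 0) => ?; case: (leP (x - 1) 0) => ?; case: (leP (x - 2) 0) => ?; lra.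
Qed.

Lemma hat_le1 x : hat x <= 1.
Proof.
rewrite /hat /ramp.
by case: (leP x 0) => ?; case: (leP (x - 1) 0) => ?; case: (leP (x - 2) 0) => ?; lra.
Qed.

Lemma smoothstep_le0 x : x <= 0 -> smoothstep x = 0.
Proof.
move=> x0; rewrite /smoothstep /ramp_sq /ramp.
by case: (leP x 0) => ?; case: (leP (x - 1) 0) => ?; case: (leP (x - 2) 0) => ?; nra.
Qed.

Lemma smoothstep_ge2 x : 2 <= x -> smoothstep x = 1.
Proof.
move=> x0; rewrite /smoothstep /ramp_sq /ramp.
by case: (leP x 0) => ?; case: (leP (x - 1) 0) => ?; case: (leP (x - 2) 0) => ?; nra.
Qed.

Lemma smoothstep_itv x : 0 <= smoothstep x <= 1.
Proof.
rewrite /smoothstep /ramp_sq /ramp; apply/andP; split;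
  case: (leP x 0) => ?; case: (leP (x - 1) 0) => ?; case: (leP (x - 2) 0) => ?; nra.
Qed.

Lemma integral_hat : \int[mu]_x hat x = 1.
Proof.
rewrite (_ : 1 = \int[mu]_(x in `[0, 2]) hat x).
  rewrite [RHS]Rintegral_mkcond; apply: eq_Rintegral => x _.
  rewrite patchE mem_setE in_itv/=; case: ifPn => //.
  rewrite negb_and -!ltNge => /orP[x0|x2]; first by rewrite hat_le0// ltW.
  by rewrite hat_ge2// ltW.
have cS x : {for x, continuous smoothstep}.
  have [dx _] := is_derive_smoothstep x.
  by apply: differentiable_continuous; apply/derivable1_diffP.
rewrite /Rintegral (@continuous_FTC2 _ _ smoothstep)//=.
- by rewrite smoothstep_ge2// smoothstep_le0// subr0.
- apply: continuous_subspaceT; exact: continuous_hat.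
- split.
  + by move=> x _; have [] := is_derive_smoothstep x.
  + by apply: cvg_at_right_filter; exact: cS.
  + by apply: cvg_at_left_filter; exact: cS.
- by move=> x _; rewrite derive1E; have [_ ->] := is_derive_smoothstep x.
Qed.

Lemma integrable_hat : mu.-integrable setT (EFin \o hat).
Proof.
have mh : measurable_fun setT hat by apply: continuous_measurable_fun; exact: continuous_hat.
have : mu.-integrable setT (EFin \o (hat \_ `[0, 2])).
  apply: integrable_patch; apply: bounded_upto_integrable; first exact: measurable_funTS.
  by exists 1 => x _; rewrite ger0_norm ?hat_ge0 ?hat_le1.
apply: eq_integrable => // x _ /=.
rewrite patchE mem_setE in_itv/=; case: ifPn => //.
rewrite negb_and -!ltNge => /orP[x0|x2]; first by rewrite hat_le0// ltW.
by rewrite hat_ge2// ltW.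
Qed.

(** For large r, a C^1 approximation of the indicator of ]x, y], with transitions
    on [x, x + 2 / r] and [y, y + 2 / r]. *)
Definition plateau (r x y t : R) : R := smoothstep (r * (t - x)) - smoothstep (r * (t - y)).

Lemma is_derive_plateau (r x y t : R) :
  is_derive t 1 (plateau r x y) (r * hat (r * (t - x)) - r * hat (r * (t - y))).
Proof.
have d z : is_derive t 1 (fun t => smoothstep (r * (t - z))) (r * hat (r * (t - z))).
  by apply: is_derive_comp_affine; exact: is_derive_smoothstep.
by have := is_deriveB (d x) (d y).
Qed.

Lemma continuous_comp_affine (f : R -> R) (r c : R) : continuous f ->
  continuous (fun t : R => f (r * (t - c))).
Proof.
move=> cf t; apply: (@continuous_comp _ _ _ (fun t => r * (t - c)) f); last exact: cf.
apply: cvgM; first exact: cvg_cst.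
by apply: cvgB; [exact: cvg_id|exact: cvg_cst].
Qed.

Lemma test_function_plateau (T r x y : R) : 0 < r -> 0 < x -> x < y -> y + 2 / r < T ->
  test_function T (plateau r x y).
Proof.
move=> r0 x0 xy yT.
have D t := is_derive_plateau r x y t.
have sub : closure [set t | plateau r x y t != 0] `<=` `[x, y + 2 / r].
  rewrite [X in _ `<=` X](closure_id _).1; last exact: itv_closed.
  apply: closure_subset => t /=; apply: contraR.
  rewrite in_itv/= negb_and -!ltNge => /orP[tx|yt]; apply/eqP; rewrite /plateau.
    rewrite !smoothstep_le0 ?subrr// pmulr_rle0// subr_le0 ltW//.
    exact: lt_trans xy.
  have yt' : 2 <= r * (t - y) by rewrite mulrC -ler_pdivrMr// lerBrDl ltW.
  rewrite !smoothstep_ge2 ?subrr// (le_trans yt')// ler_pM2l//.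
  by rewrite lerB// ltW.
split.
- by move=> t; have [] := D t.
- have -> : derive1 (plateau r x y) = (fun t => r * hat (r * (t - x)) - r * hat (r * (t - y))).
    by apply/funext => t; rewrite derive1E; have [_ ->] := D t.
  move=> t; apply: cvgB; (apply: cvgM; [exact: cvg_cst|]);
    exact: (continuous_comp_affine _ _ _ continuous_hat).
- apply: subclosed_compact sub; [exact: closed_closure|exact: segment_compact].
- apply: (subset_trans sub) => t /=; rewrite !in_itv/= => /andP[xt ty].
  by rewrite (lt_le_trans x0)//= (le_lt_trans ty).
Qed.

Lemma plateau_le1 (r x y t : R) : `|plateau r x y t| <= 1.
Proof.
have /andP[a0 a1] := smoothstep_itv (r * (t - x)).
have /andP[b0 b1] := smoothstep_itv (r * (t - y)).
rewrite /plateau ler_norml; apply/andP; split; lra.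
Qed.

(* the shift by N lets the plateaux fit in a given interval from n = 0 on *)
Local Notation rate N n := ((n + N).+1%:R : R).

Lemma smoothstep_cvg (N : nat) (t : R) :
  smoothstep (rate N n * t) @[n --> \oo] --> ((0 < t)%R%:R : R).
Proof.
case: (ltP 0 t) => t0 /=.
  apply: cvg_near_cst; near=> n; apply: smoothstep_ge2.
  rewrite -ler_pdivrMr//; apply: (@le_trans _ _ n%:R).
    by near: n; exact: nbhs_infty_ger.
  by rewrite ler_nat -addSn ltnW// ltn_addr.
apply: cvg_near_cst; apply: nearW => n; apply: smoothstep_le0.
by rewrite pmulr_rle0.
Unshelve. all: by end_near. Qed.

Lemma plateau_cvg (N : nat) (x y t : R) : x < y ->
  plateau (rate N n) x y t @[n --> \oo] --> (\1_`]x, y] t : R).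
Proof.
move=> xy; have -> : (\1_`]x, y] t : R) = (0 < t - x)%R%:R - (0 < t - y)%R%:R.
  rewrite indicE mem_setE in_itv/= !subr_gt0 leNgt.
  have [xt|tx] := ltP x t; have [yt|ty] := ltP y t => //=; rewrite ?subr0 ?subrr//.
  by have := lt_le_trans (lt_trans xy yt) tx; rewrite ltxx.
by apply: cvgB; exact: smoothstep_cvg.
Qed.

(** The functions r hat(r (t - x)) have integral 1 and concentrate at x; after
    the substitution t = u / r + x this is dominated convergence. *)
Lemma hat_mollifier (F : R -> R) (N : nat) (x : R) :
  unif_bounded F -> measurable_fun setT F -> {for x, continuous F} ->
  rate N n * \int[mu]_t (F t * hat (rate N n * (t - x))) @[n --> \oo] --> F x.
Proof.
move=> [M FM] mF cF.
have mhat : measurable_fun setT hat.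
  by apply: continuous_measurable_fun; exact: continuous_hat.
have mFn n : measurable_fun setT (fun u : R => F (u / rate N n + x) * hat u).
  apply: measurable_funM => //; apply: measurableT_comp => //.
  by apply: measurable_funD => //; exact: measurable_funM.
have -> : (fun n => rate N n * \int[mu]_t (F t * hat (rate N n * (t - x)))) =
    (fun n => \int[mu]_u (F (u / rate N n + x) * hat u)).
  apply/funext => n; have r0 : rate N n != 0 by [].
  rewrite [RHS](Rintegral_affine (rate N n) (- (rate N n * x)))// ger0_norm//.
  congr (_ * _); apply: eq_Rintegral => t _.
  congr (F _ * hat _); last by rewrite mulrBr.
  by field.
have -> : F x = \int[mu]_u (F x * hat u).
  by rewrite RintegralZl ?integral_hat ?mulr1//; exact: integrable_hat.
apply: (@Rdominated_cvg R setT _ _ (fun u => M * hat u)) => //.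
- move=> u _; apply: cvgM; last exact: cvg_cst.
  have inv : (rate N n)^-1 @[n --> \oo] --> (0 : R).
    by have := @cvg_harmonic R; rewrite -(cvg_shiftn N); apply.
  have c : u / rate N n + x @[n --> \oo] --> x.
    rewrite -[X in _ --> X]add0r -(mulr0 u); apply: cvgD; last exact: cvg_cst.
    by apply: cvgM; [exact: cvg_cst|exact: inv].
  exact: (cvg_comp _ _ c cF).
- by have := integrableZl measurableT M integrable_hat; apply: eq_integrable.
- by move=> n u _; rewrite normrM (ger0_norm (hat_ge0 _)) ler_wpM2r// hat_ge0.
Qed.

End smoothstep.

(** * Primitives of weak derivatives *)

Section weak_derivative.
Context {R : realType}.
Local Notation mu := (@lebesgue_measure R).
Implicit Types (F h v w : R -> R) (T : R).

Lemma within_itv_le F (t T : R) : t <= T ->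
  {within [set` `[0, T]], continuous F} -> {within [set` `[0, t]], continuous F}.
Proof.
by move=> tT; apply: continuous_subspaceW; apply: subset_itvl; rewrite bnd_simp.
Qed.

Lemma within_bounded_upto F T : 0 <= T ->
  {within [set` `[0, T]], continuous F} -> bounded_upto T F.
Proof.
move=> T0 cF; have [c _ cmax] := EVT_max T0 cF; have [d _ dmin] := EVT_min T0 cF.
exists (`|F c| + `|F d|) => x xT; have xT' : x \in `[0, T] by rewrite in_itv.
have h1 := cmax x xT'; have h2 := dmin x xT'.
have h3 := ler_norm (F c).
have h5 : - F d <= `|F d| by rewrite -normrN ler_norm.
have h6 := normr_ge0 (F c); have h7 := normr_ge0 (F d).
by rewrite ler_norml; apply/andP; split; lra.
Qed.

Lemma within_measurable F T :
  {within [set` `[0, T]], continuous F} -> measurable_fun `[0, T] F.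
Proof. by move=> cF; apply: subspace_continuous_measurable_fun. Qed.

Lemma within_integrable F T : 0 <= T ->
  {within [set` `[0, T]], continuous F} -> mu.-integrable `[0, T] (EFin \o F).
Proof.
move=> T0 cF; apply: bounded_upto_integrable; first exact: within_measurable.
exact: within_bounded_upto.
Qed.

(** The Cauchy-Schwarz inequality against the indicator of [0, T]. *)
Lemma in_L2_integrable T v : in_L2 T v ->
  mu.-integrable setT (EFin \o (v \_ [set` `]0, T[])).
Proof.
move=> v2; apply/Lfun1_integrable.
pose I : R -> R := (cst 1 : R -> R) \_ [set` `[0, T]].
have mI : measurable_fun setT I.
  by apply/(measurable_restrictT _ _).1 => //; exact: measurable_cst.
have iI : mu.-integrable setT (EFin \o I).
  apply: integrable_patch; apply: bounded_upto_integrable; first exact: measurable_cst.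
  by exists 1 => x _; rewrite normr1.
have i2 : I \in Lfun mu 2%:E.
  rewrite inE; apply/andP; split; rewrite inE//=.
  rewrite /finite_norm unlock poweR_lty//.
  move/integrableP : iI => [_]; apply: le_lt_trans.
  apply: ge0_le_integral => //=.
  - apply/measurable_EFinP; apply: (measurableT_comp (measurable_powR _)) => //.
    exact: measurableT_comp.
  - by apply/measurable_EFinP; exact: measurableT_comp.
  - move=> x _; rewrite lee_fin /I patchE; case: ifPn => _.
      by rewrite normr1 powR1.
    by rewrite normr0 powR0.
rewrite (_ : v \_ _ = (v \_ [set` `]0, T[]) \* I).
  exact: Lfun2_mul_Lfun1 v2 i2.
apply/funext => x; rewrite /I /= !patchE; case: ifPn => [|_]; last by rewrite mul0r.
by rewrite !mem_setE => /subset_itv_oo_cc xT; rewrite xT mulr1.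
Qed.

(** Test the weak derivative against plateau functions of ]x, y].  Their
    derivatives are differences of mollifiers at x and at y, so the integral
    against F tends to F x - F y, and they tend themselves to the indicator of
    ]x, y] while staying bounded by 1. *)
Lemma weak_derivative_itv T F v (x y : R) : 0 < x -> x < y -> y < T ->
  {within [set` `[0, T]], continuous F} -> in_L2 T v -> is_weak_derivative T F v ->
  F y - F x = \int[mu]_(t in `]x, y]) (v \_ [set` `]0, T[]) t.
Proof.
move=> x0 xy yT cF v2 Fv.
have T0 : 0 < T by rewrite (lt_trans x0)// (lt_trans xy).
have iv := in_L2_integrable _ _ v2.
set V := v \_ _ in iv *; pose G := F \_ [set` `]0, T[].
have mG : measurable_fun setT G.
  apply/(measurable_restrictT _ _).1 => //.
  apply: measurable_funS (within_measurable _ _ cF) => //; exact: subset_itv_oo_cc.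
have bG : unif_bounded G.
  have [M FM] := within_bounded_upto _ _ (ltW T0) cF.
  exists (Num.max M 0) => t; rewrite /G patchE mem_setE in_itv/=.
  case: ifPn => [/andP[t0 tT]|_]; last by rewrite normr0 le_max lexx orbT.
  by rewrite le_max FM// (ltW t0) ltW.
have iG : mu.-integrable setT (EFin \o G).
  have : mu.-integrable [set` `]0, T[] (EFin \o F).
    by apply: integrableS (within_integrable _ _ (ltW T0) cF) => //; exact: subset_itv_oo_cc.
  move=> /(@integrable_mkcond _ _ _ mu _ _ _) -/(_ (measurable_itv _)).
  by rewrite restrict_EFin.
have cG z : 0 < z < T -> {for z, continuous G} /\ G z = F z.
  move=> zT; have zT' : z \in `]0, T[ by rewrite in_itv.
  have Gz : G z = F z by rewrite /G patchE mem_setE zT'.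
  split => //; rewrite /prop_for /continuous_at Gz.
  apply: cvg_trans (within_continuous_continuous T0 cF zT').
  apply: near_eq_cvg; near=> t; rewrite /G patchE mem_setE ifT//.
  by near: t; exact: near_in_itvoo.
pose N := Num.bound (2 / (T - y)).
have yN n : y + 2 / (n + N).+1%:R < T.
  have Ty0 : 0 < T - y by rewrite subr_gt0.
  have TyN := archi_boundP (divr_ge0 (ler0n _ 2) (ltW Ty0) : 0 <= 2 / (T - y)).
  rewrite -ltrBrDl ltr_pdivrMr// mulrC -ltr_pdivrMr//.
  by rewrite (lt_le_trans TyN)// ler_nat leqW// leq_addl.
pose r (n : nat) : R := (n + N).+1%:R.
have tf n := test_function_plateau T (r n) x y (ltr0Sn _ _) x0 xy (yN n).
have lhs n : \int[mu]_(t in [set` `]0, T[]) (F t * derive1 (plateau (r n) x y) t) =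
    r n * \int[mu]_t (G t * hat (r n * (t - x))) - r n * \int[mu]_t (G t * hat (r n * (t - y))).
  have ih z : mu.-integrable setT (EFin \o (fun t => G t * hat (r n * (t - z)))).
    apply: integrableM_bounded => //; last by left.
    have r0 : r n != 0 by rewrite pnatr_eq0.
    have := integrable_affine (r n) (- (r n * z)) _ r0 integrable_hat.
    by apply: eq_integrable => // t _ /=; rewrite mulrBr.
  rewrite -!RintegralZl// -RintegralB//; last 2 first.
  - by have := integrableZl measurableT (r n) (ih x); apply: eq_integrable.
  - by have := integrableZl measurableT (r n) (ih y); apply: eq_integrable.
  rewrite Rintegral_mkcond; apply: eq_Rintegral => t _.
  have [_ dE] := is_derive_plateau (r n) x y t.
  rewrite /G !patchE; case: ifPn => _; last by rewrite !(mul0r,mulr0) subrr.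
  by rewrite derive1E dE; ring.
have rhs n : \int[mu]_(t in [set` `]0, T[]) (v t * plateau (r n) x y t) =
    \int[mu]_t (V t * plateau (r n) x y t).
  rewrite Rintegral_mkcond; apply: eq_Rintegral => t _.
  by rewrite /V !patchE; case: ifPn => // _; rewrite mul0r.
have cl : r n * \int[mu]_t (G t * hat (r n * (t - x))) -
    r n * \int[mu]_t (G t * hat (r n * (t - y))) @[n --> \oo] --> F x - F y.
  have /cG[cx <-] : 0 < x < T by rewrite x0 (lt_trans xy).
  have /cG[cy <-] : 0 < y < T by rewrite yT (lt_trans x0).
  by apply: cvgB; exact: hat_mollifier.
have cr : \int[mu]_t (V t * plateau (r n) x y t) @[n --> \oo] -->
    \int[mu]_t (V t * \1_`]x, y] t).
  apply: (@Rdominated_cvg R setT _ _ (fun t => `|V t|)) => //.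
  - move=> n; apply: measurable_funM; first exact: integrable_measurable.
    apply: continuous_measurable_fun => t.
    have [dt _] := is_derive_plateau (r n) x y t.
    by apply: differentiable_continuous; apply/derivable1_diffP.
  - by move=> t _; apply: cvgM; [exact: cvg_cst|exact: plateau_cvg].
  - exact: (integrable_norm iv).
  - by move=> n t _; rewrite normrM ler_piMr// plateau_le1.
have -> : \int[mu]_(t in `]x, y]) V t = \int[mu]_t (V t * \1_`]x, y] t).
  rewrite Rintegral_mkcond; apply: eq_Rintegral => t _.
  by rewrite patchE indicE; case: ifPn; rewrite ?mulr1 ?mulr0.
have e : (fun n => r n * \int[mu]_t (G t * hat (r n * (t - x))) -
    r n * \int[mu]_t (G t * hat (r n * (t - y)))) =
    (fun n => - \int[mu]_t (V t * plateau (r n) x y t)).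
  by apply/funext => n; rewrite -lhs -rhs; exact: Fv.
rewrite e in cl.
have := cvg_unique _ cl (cvgN cr).
by move=> /(_ (@norm_hausdorff _ _)) h; rewrite -opprB h opprK.
Unshelve. all: by end_near. Qed.

Lemma within_eq0 h T : 0 < T -> {within [set` `[0, T]], continuous h} ->
  (forall t, 0 < t < T -> h t = 0) -> forall t, 0 <= t <= T -> h t = 0.
Proof.
move=> T0 /(continuous_within_itvP _ T0)[_ h0 hT] hz t /andP[].
rewrite le_eqVlt => /predU1P[<- _|t0].
  have h0' : h s @[s --> 0^'+] --> (0 : R).
    apply: cvg_near_cst; near=> s; apply: hz.
    by apply/andP; split; near: s; [exact: nbhs_right_gt|exact: nbhs_right_lt].
  exact: (cvg_unique _ h0 h0').
rewrite le_eqVlt => /predU1P[->|tT]; last by apply: hz; rewrite t0.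
have hT' : h s @[s --> T^'-] --> (0 : R).
  apply: cvg_near_cst; near=> s; apply: hz.
  by apply/andP; split; near: s; [exact: nbhs_left_gt|exact: nbhs_left_lt].
exact: (cvg_unique _ hT hT').
Unshelve. all: by end_near. Qed.

(** Differentiate the vanishing primitive at interior points. *)
Lemma within_integral_eq0 h T : 0 < T -> {within [set` `[0, T]], continuous h} ->
  (forall t, 0 <= t <= T -> \int[mu]_(s in `[0, t]) h s = 0) ->
  forall t, 0 <= t <= T -> h t = 0.
Proof.
move=> T0 ch hz; apply: within_eq0 => // t tT; have /andP[t0 tT'] := tT.
have cht : {for t, continuous h}.
  by apply: within_continuous_continuous T0 ch _; rewrite in_itv.
have [_ <-] := continuous_FTC1_closed tT' (within_integrable _ _ (ltW T0) ch) t0 cht.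
rewrite derive1E (@near_eq_derive _ _ _ _ (cst 0)) ?derive_cst ?oner_neq0//.
near=> s; apply: hz; apply/andP; split; apply: ltW; near: s;
  [exact: lt_nbhsr|exact: lt_nbhsl].
Unshelve. all: by end_near. Qed.

Lemma within_ae_eq h1 h2 T : 0 < T ->
  {within [set` `[0, T]], continuous h1} -> {within [set` `[0, T]], continuous h2} ->
  {ae mu, forall t, t \in `[0, T] -> h1 t = h2 t} ->
  forall t, 0 <= t <= T -> h1 t = h2 t.
Proof.
move=> T0 c1 c2 h12 t tT; apply/eqP; rewrite -subr_eq0; apply/eqP; move: t tT.
apply: (@within_integral_eq0 (fun t => h1 t - h2 t)) => //.
  by move=> t; apply: cvgB; [exact: c1|exact: c2].
move=> t /andP[t0 tT].
have sub : `[0, t]%classic `<=` `[0, T]%classic by apply: subset_itvl; rewrite bnd_simp.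
have m1 : measurable_fun `[0, t] h1.
  by apply: measurable_funS (within_measurable _ _ c1).
have m2 : measurable_fun `[0, t] h2.
  by apply: measurable_funS (within_measurable _ _ c2).
rewrite /Rintegral (ae_eq_integral (cst 0%E))//.
- by rewrite integral0.
- by apply/measurable_EFinP; exact: measurable_funB.
- apply: negligibleS h12; apply: subsetC => s /= h12 st.
  by rewrite h12 ?subrr//; exact: sub.
Qed.

(** F minus the primitive of v is continuous on [0, T] and, by
    [weak_derivative_itv], constant on ]0, T[; so it is constant on [0, T]. *)
Lemma weak_derivative_FTC T F v : 0 < T ->
  {within [set` `[0, T]], continuous F} -> in_L2 T v -> is_weak_derivative T F v ->
  forall t, 0 <= t <= T -> F t - F 0 = \int[mu]_(s in `[0, t]) (v \_ [set` `]0, T[]) s.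
Proof.
move=> T0 cF v2 Fv.
set V := v \_ _.
have iV : mu.-integrable `[0, T] (EFin \o V).
  by apply: integrableS (in_L2_integrable _ _ v2).
pose I t := \int[mu]_(s in `[0, t]) V s.
have cI : {within `[0, T], continuous I}.
  exact: parameterized_integral_continuous (ltW T0) iV.
pose c := T / 2; have c0 : 0 < c by rewrite divr_gt0.
have cT : c < T by rewrite /c; lra.
have step (x y : R) : 0 < x -> x < y -> y < T -> F y - F x = I y - I x.
  move=> x0 xy yT; rewrite (weak_derivative_itv _ _ _ _ _ x0 xy yT cF v2 Fv).
  rewrite /I Rintegral_itvB ?bnd_simp ?ltW//.
  by apply: integrableS iV => //; apply: subset_itvl; rewrite bnd_simp ltW.
have key t : 0 <= t <= T -> F t - I t - (F c - I c) = 0.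
  move: t; apply: (@within_eq0 (fun t => F t - I t - (F c - I c))) => //.
    move=> t; apply: cvgB; last exact: cvg_cst.
    by apply: cvgB; [exact: cF|exact: cI].
  move=> t /andP[t0 tT]; have [tc|ct|->] := ltgtP t c; last by rewrite subrr.
  - by have := step _ _ t0 tc cT; lra.
  - by have := step _ _ c0 ct tT; lra.
move=> t tT; have := key _ tT; have := key 0.
rewrite lexx ltW// => /(_ isT).
rewrite {1}/I set_itv1 Rintegral_set1 -/(I t); lra.
Qed.

(** Apply absolute continuity to families of one interval. *)
Lemma abs_continuous_within T w : abs_continuous 0 T w ->
  {within [set` `[0, T]], continuous w}.
Proof.
move=> wac; apply/subspace_continuousP => x; rewrite /= in_itv/= => /andP[x0 xT].
apply/cvgrPdist_lt => e e0; have [d d0 wd] := wac e e0.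
near=> t.
have tT : t \in `[0, T] by near: t; exact: withinT.
have xtd : `|x - t| < d.
  near: t; apply: cvg_within; apply/nbhs_ballP; exists d => // z.
have single (a b : R) : 0 <= a -> a <= b -> b <= T -> b - a < d -> `|w b - w a| < e.
  move=> a0 ab bT bad.
  have := wd 1%N (fun=> a) (fun=> b) (fun=> conj a0 (conj ab bT)).
  rewrite !big_ord1; apply => //.
  by move=> i j _ _ _; rewrite !ord1.
move: tT xtd; rewrite in_itv/= => /andP[t0 tT]; have [xt|tx] := leP x t.
  by rewrite distrC ger0_norm ?subr_ge0// distrC; exact: single.
by rewrite gtr0_norm ?subr_gt0//; apply: single => //; exact: ltW.
Unshelve. all: by end_near. Qed.

Lemma within_continuous_graph T (f : R * R -> R) w :
  {within [set` `[0, T]] `*` [set: R], continuous f} ->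
  {within [set` `[0, T]], continuous w} ->
  {within [set` `[0, T]], continuous (fun t => f (t, w t))}.
Proof.
move=> /subspace_continuousP cf /subspace_continuousP cw.
apply/subspace_continuousP => x xT.
apply: (@cvg_comp _ _ _ (fun t => (t, w t)) f _
  (within ([set` `[0, T]] `*` [set: R]) (nbhs (x, w x)))); last by apply: cf; split.
have cpair : (fun t => (t, w t)) @ within [set` `[0, T]] (nbhs x) --> nbhs (x, w x).
  apply: (cvg_pair (G := nbhs x) (H := nbhs (w x)) (f := id) (g := w)); last exact: cw.
  exact: cvg_within.
move=> P /cpair nP.
have {}nP : \forall t \near within [set` `[0, T]] (nbhs x),
  ([set` `[0, T]] `*` [set: R]) (t, w t) -> P (t, w t) by exact: nP.
change (\forall t \near within [set` `[0, T]] (nbhs x), P (t, w t)).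
near=> t.
have tT : [set` `[0, T]] t by near: t; exact: withinT.
have : ([set` `[0, T]] `*` [set: R]) (t, w t) by split.
by near: t.
Unshelve. all: by end_near. Qed.

End weak_derivative.

(** * Volterra equations and the ABC derivative *)

Section volterra.
Context {R : realType}.
Local Notation mu := (@lebesgue_measure R).
Variables alpha k : R.
Hypothesis alpha0 : 0 < alpha.
Hypothesis k0 : 0 < k.
Local Notation p := (frac_kernel alpha).
Local Notation E := (ml_kernel alpha k).

(** The identity E + k (p # E) = 1 of [ml_kernel_resolvent], convolved with c. *)
Lemma convol_resolvent (c : R -> R) (t : R) : 0 <= t -> mu.-integrable `[0, t] (EFin \o c) ->
  k * convol (convol p E) c t = \int[mu]_(s in `[0, t]) c s - convol E c t.
Proof.
move=> t0 ic; have bE := bounded_ml_kernel _ alpha0 _ (ltW k0) t.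
have iE := integrable_ml_kernel _ alpha0 _ (ltW k0) t.
have iEc := integrable_convol _ _ _ iE ic (or_introl bE).
rewrite /convol -RintegralB// -/(convol _ _).
have -> : \int[mu]_(s in `[0, t]) (convol p E (t - s) * c s) =
    \int[mu]_(s in `[0, t]) (k^-1 * (c s - E (t - s) * c s)).
  apply: eq_Rintegral => s; rewrite inE/= in_itv/= => /andP[s0 st].
  have ts0 : 0 <= t - s by rewrite subr_ge0.
  have res := ml_kernel_resolvent alpha k alpha0 (ltW k0) (t - s) ts0.
  rewrite (_ : convol p E (t - s) = k^-1 * (1 - E (t - s))); first by ring.
  by rewrite -res addrAC subrr add0r mulKf// gt_eqF.
have iB : mu.-integrable `[0, t] (EFin \o (fun s => c s - E (t - s) * c s)).
  have := @integrableB _ _ _ mu _ (measurable_itv `[0, t]) _ _ ic iEc.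
  by apply: eq_integrable => // s _ /=; rewrite EFinB.
by rewrite RintegralZl// mulrA divff ?mul1r// gt_eqF.
Qed.

(** Convolving the equation with E gives E # h + k (E # p) # h = 0, and the
    left-hand side is 1 # h by [convol_resolvent]. *)
Lemma volterra_unique (T : R) (h : R -> R) : 0 < T ->
  {within [set` `[0, T]], continuous h} ->
  (forall t, 0 <= t <= T -> h t + k * convol p h t = 0) ->
  forall t, 0 <= t <= T -> h t = 0.
Proof.
move=> T0 ch hk; apply: within_integral_eq0 => // t /andP[t0 tT].
have cht := within_itv_le _ _ _ tT ch.
have ih := within_integrable _ _ t0 cht; have bh := within_bounded_upto _ _ t0 cht.
have bE := bounded_ml_kernel _ alpha0 _ (ltW k0) t.
have iE := integrable_ml_kernel _ alpha0 _ (ltW k0) t.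
have ip := integrable_frac_kernel _ t alpha0.
have swap : convol E (convol p h) t = convol (convol p E) h t.
  rewrite (convol_assoc _ _ _ _ iE ip ih (or_introl bE) (or_intror bh)).
  apply: eq_Rintegral => s; rewrite inE/= in_itv/= => /andP[s0 st]; congr (_ * _).
  by apply: convol_comm; apply: measurable_funTS;
    [exact: measurable_ml_kernel|exact: measurable_frac_kernel].
have scale : convol E (convol p h) t = - k^-1 * convol E h t.
  rewrite -(convolZr _ _ _ _ iE ih (or_introl bE)); apply: eq_Rintegral => s.
  rewrite inE/= in_itv/= => /andP[s0 st]; congr (_ * _).
  have /hk/eqP : 0 <= s <= T by rewrite s0 (le_trans st tT).
  rewrite addr_eq0 => /eqP ->; rewrite mulNr mulrN opprK mulrA mulVf ?mul1r// gt_eqF//.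
have := convol_resolvent _ _ t0 ih; rewrite -swap scale mulrA mulrN divff ?gt_eqF//.
lra.
Qed.

End volterra.

Section abc.
Context {R : realType}.
Local Notation mu := (@lebesgue_measure R).
Variables (B : R -> R) (alpha T : R).
Hypothesis Ba0 : 0 < B alpha.
Hypothesis T0 : 0 < T.
Hypothesis alpha0 : 0 < alpha.
Hypothesis alpha1 : alpha < 1.
Local Notation p := (frac_kernel alpha).
Local Notation k := (alpha / (1 - alpha)).
Local Notation E := (ml_kernel alpha k).

Lemma rate_gt0 : 0 < k.
Proof. by rewrite divr_gt0// subr_gt0. Qed.

(** The weak derivative is controlled on ]0, T[ only; cutting it off there
    changes the integrand at most at the end points of [0, t]. *)
Lemma abc_derivative_convol (F : R -> R) (t : R) : 0 <= t <= T ->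
  in_L2 T (weak_derivative T F) ->
  abc_derivative B alpha T F t =
  B alpha / (1 - alpha) * convol E (weak_derivative T F \_ [set` `]0, T[]) t.
Proof.
move=> /andP[t0 tT] v2; rewrite /abc_derivative; congr (_ * _).
have mE : measurable_fun setT (fun s : R => E (t - s)).
  apply: (measurableT_comp (measurable_ml_kernel _ alpha0 _)); exact: measurable_funB.
have mV := integrable_measurable _ (in_L2_integrable _ _ v2).
apply: (congr1 fine); apply: eq_integral_itv_bounded.
- apply: measurable_funM; first exact: measurable_funTS.
  have : measurable_fun `]0, t[ (weak_derivative T F \_ [set` `]0, T[]).
    exact: measurable_funTS.
  apply: eq_measurable_fun => s; rewrite inE/= in_itv/= => /andP[s0 st].
  by rewrite patchE mem_setE in_itv/= s0 (lt_le_trans st).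
- by apply: measurable_funM; exact: measurable_funTS.
move=> s; rewrite in_itv/= => /andP[s0 st].
by rewrite patchE mem_setE in_itv/= s0 (lt_le_trans st).
Qed.

(** The Newton-Leibniz formula of the ABC calculus: the ABC integral of the ABC
    derivative.  Up to constants, the right-hand side is E # V + k p # (E # V)
    for the weak derivative V of F, which is 1 # V by associativity and the
    resolvent identity. *)
Lemma abc_integral_derivative (F : R -> R) : {within [set` `[0, T]], continuous F} ->
  has_continuous_abc_derivative B alpha T F ->
  forall t, 0 <= t <= T ->
  F t - F 0 = (1 - alpha) / B alpha * abc_derivative B alpha T F t +
    alpha / B alpha * convol p (abc_derivative B alpha T F) t.
Proof.
move=> cF [[F2 [v v2v]] cD] t tT; have /andP[t0 tT'] := tT.
have [v2 Fv] : in_L2 T (weak_derivative T F) /\ is_weak_derivative T F (weak_derivative T F).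
  exact: (@xgetPex _ (fun=> 0) [set v | in_L2 T v /\ is_weak_derivative T F v]
    (ex_intro _ v v2v)).
rewrite (weak_derivative_FTC _ _ _ T0 cF v2 Fv)//.
have DE s : 0 <= s <= T -> _ := fun sT => abc_derivative_convol F s sT v2.
set D := abc_derivative _ _ _ _ in DE cD *.
set V := _ \_ _ in DE *.
have iV : mu.-integrable `[0, t] (EFin \o V).
  by apply: integrableS (in_L2_integrable _ _ v2).
have cDt := within_itv_le _ _ _ tT' cD.
have iD := within_integrable _ _ t0 cDt; have bD := within_bounded_upto _ _ t0 cDt.
have bE := bounded_ml_kernel _ alpha0 _ (ltW rate_gt0) t.
have iE := integrable_ml_kernel _ alpha0 _ (ltW rate_gt0) t.
have ip := integrable_frac_kernel _ t alpha0.
have a1 : 1 - alpha != 0 by rewrite gt_eqF// subr_gt0.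
have B0 : B alpha != 0 by rewrite gt_eqF.
have pD : convol p (convol E V) t = (1 - alpha) / B alpha * convol p D t.
  rewrite -(convolZr _ _ _ _ ip iD (or_intror bD)); apply: eq_Rintegral => s.
  rewrite inE/= in_itv/= => /andP[s0 st]; congr (_ * _).
  rewrite DE ?s0 ?(le_trans st)//; field.
  by rewrite a1 B0.
have := convol_resolvent _ _ alpha0 rate_gt0 V t t0 iV.
rewrite -(convol_assoc _ _ _ _ ip iE iV (or_intror bE) (or_introl bE)).
rewrite pD => /eqP; rewrite eq_sym subr_eq => /eqP ->.
rewrite (DE t tT); field.
by rewrite a1 B0.
Qed.

Lemma frac_integral_convol (G : R -> R) (t : R) : 0 <= t <= T ->
  {within [set` `[0, T]], continuous G} ->
  alpha / (B alpha * gamma_fun alpha) *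
    \int[mu]_(s in `[0, t]) ((t - s) `^ (alpha - 1) * G s) =
  alpha / B alpha * convol p G t.
Proof.
move=> /andP[t0 tT] cG.
have cGt := within_itv_le _ _ _ tT cG.
have iG := within_integrable _ _ t0 cGt; have bG := within_bounded_upto _ _ t0 cGt.
have ip := integrable_frac_kernel _ t alpha0.
have G0 : gamma_fun alpha != 0 by rewrite gt_eqF// gamma_fun_gt0.
have -> : \int[mu]_(s in `[0, t]) ((t - s) `^ (alpha - 1) * G s) =
    gamma_fun alpha * convol p G t.
  rewrite /convol -RintegralZl//; last exact: integrable_convol _ _ _ ip iG (or_intror bG).
  apply: eq_Rintegral => s _; rewrite /frac_kernel.
  by move: (gamma_fun alpha) G0 => A A0; field.
have B0 : B alpha != 0 by rewrite gt_eqF.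
by move: (gamma_fun alpha) G0 => A A0; field; rewrite A0 B0.
Qed.

End abc.

(** * Equivalence of the hybrid problem with the integral equation *)

Theorem theorem3p1 (R : realType) (B : R -> R) (T alpha w0 : R)
    (f g : R * R -> R) (w : R -> R)
    (B_gt0 : forall a : R, a \in `[0, 1] -> 0 < B a)
    (B0 : B 0 = 1) (B1 : B 1 = 1)
    (T_gt0 : 0 < T)
    (alpha_gt0 : 0 < alpha) (alpha_lt1 : alpha < 1)
    (f_cont : {within [set` `[0, T]] `*` [set: R], continuous f})
    (f_neq0 : forall tau u : R, tau \in `[0, T] -> f (tau, u) != 0)
    (f_ac : forall u : R, abs_continuous 0 T (fun tau => u / f (tau, u)))
    (g_cont : {within [set` `[0, T]] `*` [set: R], continuous g})
    (f_incr : forall tau : R, tau \in `[0, T] ->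
      {homo (fun x : R => x / f (tau, x)) : x y / x < y})
    (w_ac : abs_continuous 0 T w)
    (w_abc : has_continuous_abc_derivative B alpha T (hybrid_quotient f w))
    (g_w0 : g (0, w 0) = 0) :
  is_abc_hybrid_solution B alpha T f g w0 w <->
  (forall tau : R, tau \in `[0, T] ->
    w tau = f (tau, w tau) *
      (w0 / f (0, w0)
       + (1 - alpha) / B alpha * g (tau, w tau)
       + alpha / (B alpha * gamma_fun alpha) *
         \int[lebesgue_measure]_(s in `[0, tau])
           ((tau - s) `^ (alpha - 1) * g (s, w s)))).
Proof.
have Ba0 : 0 < B alpha by apply: B_gt0; rewrite in_itv/= !ltW.
have a10 : 0 < 1 - alpha by rewrite subr_gt0.
set F := hybrid_quotient f w; set D := abc_derivative B alpha T F.
pose G t := g (t, w t).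
have cw := abs_continuous_within _ _ w_ac.
have cG : {within [set` `[0, T]], continuous G} := within_continuous_graph _ _ _ g_cont cw.
have fw0 t : 0 <= t <= T -> f (t, w t) != 0 by move=> tT; apply: f_neq0; rewrite in_itv.
have cF : {within [set` `[0, T]], continuous F}.
  have cf := within_continuous_graph _ _ _ f_cont cw.
  apply/subspace_continuousP => t tT.
  have cwt := (subspace_continuousP _ _).1 cw t tT.
  have cft := (subspace_continuousP _ _).1 cf t tT.
  by apply: cvgM; [exact: cwt|apply: cvgV; [exact: f_neq0|exact: cft]].
have cD : {within [set` `[0, T]], continuous D} by case: w_abc.
have FD := abc_integral_derivative _ _ _ Ba0 T_gt0 alpha_gt0 alpha_lt1 F cF w_abc.
have Gint t : 0 <= t <= T -> _ :=
  fun tT => frac_integral_convol _ _ _ Ba0 alpha_gt0 G t tT cG.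
have T0 : 0 <= (0 : R) <= T by rewrite lexx ltW.
split=> [[_ _ Dg w0E] tau|sol].
  rewrite in_itv/= => tT.
  have DG s : 0 <= s <= T -> D s = G s := within_ae_eq _ _ _ T_gt0 cD cG Dg s.
  have := FD tau tT; rewrite -/D DG// (_ : convol _ D tau = convol (frac_kernel alpha) G tau).
    rewrite -Gint// => FG.
    rewrite -w0E -/(F 0) -addrA -FG addrC subrK /F /hybrid_quotient mulrC divfK//.
    exact: fw0.
  apply: eq_Rintegral => s; rewrite inE/= in_itv/= => /andP[s0 st]; congr (_ * _).
  by apply: DG; rewrite s0 (le_trans st)//; case/andP: tT.
have {}sol t : 0 <= t <= T -> F t = w0 / f (0, w0) + (1 - alpha) / B alpha * G t +
    alpha / B alpha * convol (frac_kernel alpha) G t.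
  move=> tT; rewrite /F /hybrid_quotient {1}sol ?in_itv// -Gint//.
  by rewrite mulrC mulKf// fw0.
(* at time 0 the integral and g (0, w 0) vanish *)
have F0 : F 0 = w0 / f (0, w0).
  rewrite sol// {1}/G g_w0 mulr0 addr0 /convol set_itv1 Rintegral_set1 mulr0 addr0//.
have w0E : w 0 = w0.
  have inc := f_incr 0; rewrite in_itv/= in inc.
  apply/eqP; rewrite eq_le !leNgt; apply/andP; split; apply/negP => /(inc T0);
    by rewrite -[w 0 / _]/(F 0) F0 ltxx.
split => //.
have hz : forall t, 0 <= t <= T -> G t - D t = 0.
  apply: (volterra_unique alpha (alpha / (1 - alpha)) alpha_gt0 (divr_gt0 alpha_gt0 a10)
    T (fun t => G t - D t)) => //.
    by move=> t; apply: cvgB; [exact: cG|exact: cD].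
  move=> t tT; have /andP[t0 tT'] := tT.
  have cGt := within_itv_le _ _ _ tT' cG; have cDt := within_itv_le _ _ _ tT' cD.
  have iG := within_integrable _ _ t0 cGt; have bG := within_bounded_upto _ _ t0 cGt.
  have iD := within_integrable _ _ t0 cDt; have bD := within_bounded_upto _ _ t0 cDt.
  have ip := integrable_frac_kernel _ t alpha_gt0.
  have cGD : convol (frac_kernel alpha) (fun s => G s - D s) t =
      convol (frac_kernel alpha) G t - convol (frac_kernel alpha) D t.
    have iGp := integrable_convol _ _ _ ip iG (or_intror bG).
    have iDp := integrable_convol _ _ _ ip iD (or_intror bD).
    rewrite /convol -RintegralB//.
    by apply: eq_Rintegral => s _; rewrite mulrBr.
  have := FD t tT; rewrite sol// F0 cGD -/D.
  move: (w0 / f (0, w0)) (convol _ G t) (convol _ D t) => c0 cg cd e.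
  have Bn0 : B alpha != 0 by rewrite gt_eqF.
  have a0 : 1 - alpha != 0 by rewrite gt_eqF.
  have -> : G t - D t + alpha / (1 - alpha) * (cg - cd) =
      B alpha / (1 - alpha) * ((c0 + (1 - alpha) / B alpha * G t +
        alpha / B alpha * cg - c0) -
      ((1 - alpha) / B alpha * D t + alpha / B alpha * cd)).
    by field; rewrite a0 Bn0.
  by rewrite e subrr mulr0.
apply: aeW => tau; rewrite in_itv/= => tT.
by apply/esym/eqP; rewrite -subr_eq0; apply/eqP; exact: hz.
Qed.
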